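(* Let $X,Y$ be locally compact Hausdorff spaces, and let $\mathcal{E}$ and $\mathcal{E}'$ be $C^*$-correspondences from $C_0(Y)$ to $C_0(X)$ which have proper twisted $Y$-$X$-correspondences $(Z,r,s,\mathcal{L})$ and $(Z',r',s',\mathcal{L}')$, respectively, associated to them. Let $\mathcal{V},\mathcal{V}'$ be the Hermitian vector bundles with $\Gamma_0(\mathcal{V})\cong\mathcal{E}$, $\Gamma_0(\mathcal{V}')\cong\mathcal{E}'$. Let $(U_i,h_i)_{i\in I}$ and $(U_i,h_i')_{i\in I}$ be normalizing atlases of $\mathcal{V}$ and $\mathcal{V}'$ diagonalizing the left actions that correspond to $(Z,r,s,\mathcal{L})$ and $(Z',r',s',\mathcal{L}')$, respectively. Let $D\subset\mathcal{K}(\mathcal{E})$ and $D'\subset\mathcal{K}(\mathcal{E}')$ be the Cartan subalgebras corresponding to $(Z,r,s,\mathcal{L})$ and $(Z',r',s',\mathcal{L}')$. Then the following are equivalent: (a) The twisted correspondences $(Z,r,s,\mathcal{L})$ and $(Z',r',s',\mathcal{L}')$ are isomorphic. (b) The atlases $(U_i,h_i)$ and $(U_i,h_i')$ are equivalent. (c) There exists an isomorphism $\Phi:\mathcal{E}\to\mathcal{E}'$ of $C^*$-correspondences such that for all $i\in I$, all $x\in U_i$ and all $k=1,\dots,n_x$ there exist $l\in\{1,\dots,n_x\}$ and $\lambda\in\mathbb{T}$ with $\Phi(\xi_{ik})(x)=\lambda\,\xi'_{il}(x)$. (d) There exists an isomorphism $\Phi:\mathcal{E}\to\mathcal{E}'$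 of $C^*$-correspondences such that the induced isomorphism $\mathcal{K}(\mathcal{E})\to\mathcal{K}(\mathcal{E}')$ maps $D$ to $D'$.
   Context: **$C^*$-correspondences.** A $C^*$-correspondence from $B$ to $A$ is a right Hilbert $A$-module with a $*$-homomorphism $\varphi:B\to\mathcal{L}(\mathcal{E})$. Isomorphisms are inner-product preserving $A$-linear bijections intertwining the left actions. **Twisted correspondences.** A proper twisted $Y$-$X$-correspondence $(Z,r,s,\mathcal{L})$ consists of a locally compact Hausdorff space $Z$, a local homeomorphism $s:Z\to X$ proper onto its image (hence a covering map onto its image with finite fibers), a proper continuous map $r:Z\to Y$, and a Hermitian line bundle $\mathcal{L}$ over $Z$. Isomorphism: a homeomorphism $\phi:Z\to Z'$ with $s'\circ\phi=s$, $r'\circ\phi=r$, $\phi^*\mathcal{L}'\cong\mathcal{L}$. $\Gamma_0(Z,r,s,\mathcal{L})$ is $\Gamma_0(\mathcal{L})$ with $\langle\xi,\eta\rangle(x)=\sum_{s(z)=x}\langle\xi(z),\eta(z)\rangle_{\mathcal{L}}$, $(\xi f)(z)=\xi(z)f(s(z))$, $(\varphi(g)\xi)(z)=g(r(z))\xi(z)$ for $f\in C_0(X)$, $g\in C_0(Y)$. Associated to $\mathcal{E}$: $\Gamma_0(Z,r,s,\mathcal{L})\cong\mathcal{E}$ as $C^*$-correspondences. In this case $\mathcal{E}\cong\Gamma_0(\mathcal{V})$ as Hilbert modules for a Hermitian vector bundle $\mathcal{V}$ over the open set $s(Z)\subset X$ with fibers of dimension $n_x=|s^{-1}(x)|$.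 **Atlases.** An atlas $(U_i,h_i)$ of $\mathcal{V}$ consists of fibrewise isometric trivializations $h_i:U_i\times\mathbb{C}^n\to\mathcal{V}|_{U_i}$ over an open cover, with $g_{ij}(x)=h_i^{-1}\circ h_j(x,\cdot)$. $\mathcal{U}(N_{D_n})$ is the group of products of a unitary diagonal matrix and a permutation matrix in $M_n$. Normalizing: $g_{ij}(x)\in\mathcal{U}(N_{D_{n_x}})$ always. Diagonalizing the left action: each $U_i$ has compact closure and each $h_i(x,e_k)$ is an eigenvector of the fiber operator $\varphi(f)_x$ for all $f\in C_0(Y)$. Two such atlases $(U_i,h_i)$ of $\mathcal{V}$ and $(U_i,h_i')$ of $\mathcal{V}'$ are equivalent if $\dim\mathcal{V}_x=\dim\mathcal{V}'_x$ for all $x$ and there are continuous $r_i$ on $U_i$ with $r_i(x)\in\mathcal{U}(N_{D_{n_x}})$ and $g'_{ij}(x)=r_i(x)^{-1}g_{ij}(x)r_j(x)$, such that the bundle isomorphism $\mathcal{V}_x\ni v\mapsto h_i'(x,r_i(x)^{-1}h_i^{-1}(v))$ ($x\in U_i$) induces an isomorphism $\Gamma_0(\mathcal{V})\to\Gamma_0(\mathcal{V}')$ intertwining the left actions. **Sections.** For each $i$ fix a nonnegative continuous function $\gamma_i$ with open support $U_i$ (the same for both atlases) and set $\xi_{ik}(x)=h_i(x,\gamma_i(x)e_k)$, $\xi'_{ik}(x)=h'_i(x,\gamma_i(x)e_k)$, viewed in $\mathcal{E}$ and $\mathcal{E}'$. **Corresponding atlas.** An atlas corresponds to $(Z,r,s,\mathcal{L})$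 if the following twisted correspondence built from it is isomorphic to $(Z,r,s,\mathcal{L})$: writing $g_{ij}(x)=\lambda_{ij}(x)\sigma_{ij}(x)$ (diagonal times permutation, $e_k\mapsto e_{\sigma_{ij}(x)k}$), the space is $\bigsqcup_iU_i\times\{1,\dots,n\}$ modulo $(x,k,j)\sim(x,\sigma_{ij}(x)k,i)$, the source map is $[x,k,i]\mapsto x$, the line bundle is $\bigsqcup_iU_i\times\{1,\dots,n\}\times\mathbb{C}$ modulo $(x,k,w,j)\sim(x,\sigma_{ij}(x)k,\lambda_{ij}(x)_{\sigma_{ij}(x)k}w,i)$, and the range map $\rho$ is determined by $\varphi(f)_xh_i(x,e_k)=f(\rho[x,k,i])h_i(x,e_k)$ for all $f\in C_0(Y)$. **Corresponding Cartan.** $D\subset\mathcal{K}(\mathcal{E})$ corresponds to $(Z,r,s,\mathcal{L})$ if some isomorphism $\mathcal{E}\cong\Gamma_0(Z,r,s,\mathcal{L})$ of $C^*$-correspondences carries $D$ to $\{\Theta_f:f\in C_0(Z)\}$, where $(\Theta_f\xi)(z)=f(z)\xi(z)$ (this is a Cartan subalgebra). *)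

(* Defs.v *)
From HB Require Import structures.
From Stdlib Require Import Relation_Operators.
From mathcomp Require Import all_boot all_order all_algebra generic_quotient.
From mathcomp Require Import all_classical all_reals all_analysis.
From mathcomp Require Import complex.

Set Implicit Arguments.
Unset Strict Implicit.
Unset Printing Implicit Defensive.

Import Order.TTheory GRing.Theory Num.Theory.
Import numFieldNormedType.Exports.

Local Open Scope classical_set_scope.
Local Open Scope ring_scope.
Local Open Scope sesquilinear_scope.
Local Open Scope quotient_scope.

(* R[i], typed so that the norm topology is inferred on it. *)
Definition Cplx (R : realType) : numClosedFieldType := R[i].

Section homeomorphism.
Variables S T : topologicalType.

Definition homeo_on (A : set S) (B : set T) (f : S -> T) : Prop :=
  set_bij A B f /\ {within A, continuous f} /\
  exists g : T -> S,
    [/\ set_fun B A g, {in A, cancel f g} & {within B, continuous g}].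

Definition homeomorphism (f : S -> T) : Prop := homeo_on setT setT f.

Definition local_homeomorphism (f : S -> T) : Prop :=
  forall z, exists O : set S,
    [/\ open O, O z, open (f @` O) & homeo_on O (f @` O) f].

Definition proper (f : S -> T) : Prop :=
  forall K : set T, compact K -> compact (f @^-1` K).

Definition proper_onto_image (f : S -> T) : Prop :=
  forall K : set T, K `<=` range f -> compact K -> compact (f @^-1` K).
End homeomorphism.

Section C0.
Variables (R : realType) (X : topologicalType).
Local Notation C := (Cplx R).

Definition vanishes_at_infinity (f : X -> C) : Prop :=
  forall eps : C, 0 < eps ->
    exists K : set X, compact K /\ forall x, ~ K x -> `|f x| < eps.

Definition c0_pred : {pred X -> C} :=
  mem [set f : X -> C | continuous f /\ vanishes_at_infinity f].

Lemma c0_submod_closed : submod_closed c0_pred.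
Proof.
split.
  rewrite inE; split; first exact: cst_continuous.
  by move=> eps e0; exists set0; split=> [|x _]; [exact: compact0|rewrite normr0].
move=> a f g; rewrite !inE => -[cf vf] [cg vg]; split.
  by move=> x; apply: cvgD; [exact: (cvgM (cvg_cst a) (cf x))|exact: cg].
move=> eps e0.
have a0 : 0 < `|a| + 1 :> C by rewrite ltr_wpDl.
have e2 : 0 < eps / 2 by rewrite divr_gt0.
have [K [cK fK]] := vf (eps / 2 / (`|a| + 1)) (divr_gt0 e2 a0).
have [L [cL gL]] := vg (eps / 2) e2.
exists (K `|` L); split; first exact: compactU.
move=> x /not_orP[/fK fx /gL gx].
rewrite [in ltRHS](splitr eps) (le_lt_trans (ler_normD _ _))// ler_ltD// normrM.
rewrite (le_trans (ler_wpM2l (normr_ge0 _) (ltW fx)))// mulrCA ler_piMr//.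
  exact: ltW.
by rewrite ler_pdivrMr// mul1r lerDl.
Qed.

HB.instance Definition _ := GRing.isSubmodClosed.Build C (X -> C) c0_pred
  c0_submod_closed.

Record C0 := MkC0 { c0_fun :> X -> C ; c0_funP : c0_fun \in c0_pred }.

HB.instance Definition _ := [isSub for c0_fun].
HB.instance Definition _ := [Choice of C0 by <:].
HB.instance Definition _ := [SubChoice_isSubLmodule of C0 by <:].

Lemma c0_mul_subproof (f g : C0) : (fun x => f x * g x) \in c0_pred.
Proof.
case: f g => f + [g]; rewrite /= !inE => -[cf vf] [cg vg]; split.
  by move=> x; apply: cvgM; [exact: cf|exact: cg].
move=> eps e0.
have [K [cK fK]] := vf 1 ltr01; have [L [cL gL]] := vg eps e0.
exists (K `|` L); split; first exact: compactU.
move=> x /not_orP[/fK fx /gL gx]; rewrite normrM.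
by rewrite (le_lt_trans _ gx)// ler_piMl// ltW.
Qed.

Lemma c0_conj_subproof (f : C0) : (fun x => (f x)^*) \in c0_pred.
Proof.
case: f => f; rewrite /= !inE => -[cf vf]; split; last first.
  move=> eps /vf[K [cK fK]]; exists K; split=> // x /fK.
  by rewrite norm_conjC.
move=> x; apply/cvgrPdist_lt => eps e0.
move/cvgrPdist_lt: (cf x) => /(_ eps e0); apply: filterS => y.
by rewrite -rmorphB norm_conjC.
Qed.

Definition c0_mul (f g : C0) : C0 := MkC0 (c0_mul_subproof f g).
Definition c0_conj (f : C0) : C0 := MkC0 (c0_conj_subproof f).

Definition c0_norm (f : C0) : R := sup [set complex.Re `|f x| | x in setT].
End C0.

Section hilbert_modules.
Variables (R : realType) (X : topologicalType).
Local Notation C := (Cplx R).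
Local Notation C0X := (C0 R X).

Definition ip_norm (E : Type) (ip : E -> E -> C0X) (xi : E) : R :=
  Num.sqrt (c0_norm (ip xi xi)).

(* Right Hilbert C_0(X)-modules; inner products are linear in the second
   variable. *)
Record hilbertModule := HilbertModule {
  hm_car :> lmodType C ;
  hm_act : hm_car -> C0X -> hm_car ;
  hm_ip : hm_car -> hm_car -> C0X ;
  hm_act_linearl : forall (f : C0X) (a : C) (xi eta : hm_car),
    hm_act (a *: xi + eta) f = a *: hm_act xi f + hm_act eta f ;
  hm_act_linearr : forall (xi : hm_car) (a : C) (f g : C0X),
    hm_act xi (a *: f + g) = a *: hm_act xi f + hm_act xi g ;
  hm_actM : forall (xi : hm_car) (f g : C0X),
    hm_act xi (c0_mul f g) = hm_act (hm_act xi f) g ;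
  hm_ip_linear : forall (xi : hm_car) (a : C) (eta zeta : hm_car),
    hm_ip xi (a *: eta + zeta) = a *: hm_ip xi eta + hm_ip xi zeta ;
  hm_ip_act : forall (xi eta : hm_car) (f : C0X),
    hm_ip xi (hm_act eta f) = c0_mul (hm_ip xi eta) f ;
  hm_ip_conj : forall xi eta : hm_car,
    hm_ip eta xi = c0_conj (hm_ip xi eta) ;
  hm_ip_ge0 : forall (xi : hm_car) (x : X), 0 <= hm_ip xi xi x ;
  hm_ip_eq0 : forall xi : hm_car, hm_ip xi xi = 0 -> xi = 0 ;
  hm_complete : forall u : nat -> hm_car,
    (forall eps : R, 0 < eps -> exists N : nat, forall p q : nat,
       (N <= p)%N -> (N <= q)%N -> ip_norm hm_ip (u p - u q) < eps) ->
    exists l : hm_car, forall eps : R, 0 < eps -> exists N : nat,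
      forall p : nat, (N <= p)%N -> ip_norm hm_ip (u p - l) < eps }.

Definition hm_norm (E : hilbertModule) (xi : E) : R := ip_norm (@hm_ip E) xi.

Definition adjoint_pair (E : hilbertModule) (S T : E -> E) : Prop :=
  forall xi eta : E, hm_ip (S xi) eta = hm_ip xi (T eta).

Definition adjointable_ops (E : hilbertModule) : set (E -> E) :=
  [set S | exists T, adjoint_pair S T].

(* zeta |-> \sum_i xi_i <eta_i, zeta>, for a list of pairs (xi_i, eta_i) *)
Definition finite_rank_op (E : hilbertModule) (s : seq (E * E)) : E -> E :=
  fun zeta => \sum_(p <- s) hm_act p.1 (hm_ip p.2 zeta).

(* K(E): norm closure in L(E) of the finite rank operators *)
Definition compact_ops (E : hilbertModule) : set (E -> E) :=
  [set S | adjointable_ops S /\ forall eps : R, 0 < eps ->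
     exists s : seq (E * E), forall xi : E,
       hm_norm (S xi - finite_rank_op s xi) <= eps * hm_norm xi].
End hilbert_modules.

Section correspondences.
Variables (R : realType) (Y X : topologicalType).
Local Notation C := (Cplx R).

(* C*-correspondences from C_0(Y) to C_0(X); corr_phi f lies in L(E) because
   corr_phi (c0_conj f) is its adjoint. *)
Record correspondence := Correspondence {
  corr_hm :> hilbertModule R X ;
  corr_phi : C0 R Y -> corr_hm -> corr_hm ;
  corr_phi_adj : forall f : C0 R Y,
    adjoint_pair (corr_phi f) (corr_phi (c0_conj f)) ;
  corr_phi_linear : forall (a : C) (f g : C0 R Y) (xi : corr_hm),
    corr_phi (a *: f + g) xi = a *: corr_phi f xi + corr_phi g xi ;
  corr_phiM : forall (f g : C0 R Y) (xi : corr_hm),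
    corr_phi (c0_mul f g) xi = corr_phi f (corr_phi g xi) }.

Definition corr_iso (E E' : correspondence) (Phi : E -> E') : Prop :=
  [/\ bijective Phi,
      forall (a : C) (xi eta : E), Phi (a *: xi + eta) = a *: Phi xi + Phi eta,
      forall (xi : E) (f : C0 R X), Phi (hm_act xi f) = hm_act (Phi xi) f,
      forall xi eta : E, hm_ip (Phi xi) (Phi eta) = hm_ip xi eta &
      forall (f : C0 R Y) (xi : E), Phi (corr_phi f xi) = corr_phi f (Phi xi)].
End correspondences.

Section bundles.
Variable R : realType.
Local Notation C := (Cplx R).

Definition has_dim (F : lmodType C) (n : nat) : Prop :=
  exists h : 'cV[C]_n -> F,
    (forall (a : C) v w, h (a *: v + w) = a *: h v + h w) /\ bijective h.

(* A family of sesquilinear spaces over B together with a topologized total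
   space: [pt x v] is the point of the total space given by v in the fiber
   over x, and [pr] is the bundle projection. *)
Record bundleData (B : topologicalType) := BundleData {
  fib : B -> lmodType C ;
  fip : forall x : B, fib x -> fib x -> C ;
  tot : topologicalType ;
  pt : forall x : B, fib x -> tot ;
  pr : tot -> B }.
Arguments fib {B} _ _.
Arguments fip {B _ x} _ _.
Arguments tot {B} _.
Arguments pt {B _ x} _.
Arguments pr {B} _ _.

Section over_base.
Variables (B : topologicalType) (V : bundleData B).

Definition is_trivialization (n : nat) (U : set B)
    (h : forall x, 'cV[C]_n -> fib V x) : Prop :=
  [/\ open U,
      forall x, U x -> forall (a : C) v w, h x (a *: v + w) = a *: h x v + h x w,
      forall x, U x -> bijective (h x) &
      homeo_on (U `*` setT) (pr V @^-1` U)
        (fun p : B * 'cV[C]_n => pt (h p.1 p.2))].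

(* A Hermitian vector bundle over the open set W of B, extended by zero fibers
   outside W so that its sections are functions on all of B.  Consequently
   [tot V] also has one point over each x outside W; the topology around these
   points is unconstrained and never used. *)
Record is_hermitian_bundle (W : set B) : Prop := IsHermitianBundle {
  hb_open : open W ;
  hb_prK : forall x (v : fib V x), pr V (pt v) = x ;
  hb_pt_inj : forall x (v w : fib V x), pt v = pt w -> v = w ;
  hb_pt_surj : forall t : tot V, exists v : fib V (pr V t), pt v = t ;
  hb_zero : forall x, ~ W x -> forall v : fib V x, v = 0 ;
  hb_ip_linear : forall x (v w u : fib V x) (a : C),
    fip v (a *: w + u) = a * fip v w + fip v u ;
  hb_ip_conj : forall x (v w : fib V x), fip w v = (fip v w)^* ;
  hb_ip_ge0 : forall x (v : fib V x), 0 <= fip v v ;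
  hb_ip_eq0 : forall x (v : fib V x), fip v v = 0 -> v = 0 ;
  hb_pr_continuous : {within pr V @^-1` W, continuous (pr V)} ;
  hb_locally_trivial : forall x, W x ->
    exists (n : nat) (U : set B) (h : forall y, 'cV[C]_n -> fib V y),
      [/\ U x, U `<=` W, is_trivialization U h &
          forall v w : 'cV[C]_n,
            {within U, continuous (fun y => fip (h y v) (h y w))}] }.

Definition Gamma0 (W : set B) : set (forall x, fib V x) :=
  [set xi | [/\ forall x, ~ W x -> xi x = 0,
                {within W, continuous (fun x => pt (xi x))} &
                forall eps : C, 0 < eps -> exists K : set B,
                  [/\ compact K, K `<=` W &
                      forall x, ~ K x -> sqrtC (fip (xi x) (xi x)) < eps]]].

Definition is_hermitian_line_bundle : Prop :=
  is_hermitian_bundle setT /\ forall x, has_dim (fib V x) 1.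
End over_base.

(* L ~= phi^* L' as Hermitian line bundles, i.e. a fiberwise unitary
   homeomorphism of total spaces covering phi *)
Definition bundle_iso_over (B B' : topologicalType) (phi : B -> B')
    (L : bundleData B) (L' : bundleData B') : Prop :=
  exists u : forall z, fib L z -> fib L' (phi z),
    [/\ forall z (a : C) v w, u z (a *: v + w) = a *: u z v + u z w,
        forall z, bijective (u z),
        forall z v w, fip (u z v) (u z w) = fip v w &
        exists F : tot L -> tot L',
          homeomorphism F /\ forall z v, F (pt v) = pt (u z v)].
End bundles.
Arguments fib {R B} _ _.
Arguments fip {R B _ x} _ _.
Arguments tot {R B} _.
Arguments pt {R B _ x} _.
Arguments pr {R B} _ _.

Section twisted.
Variables (R : realType) (Y X : topologicalType).
Local Notation C := (Cplx R).

Record twistedData := TwistedData {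
  tw_space : topologicalType ;
  tw_r : tw_space -> Y ;
  tw_s : tw_space -> X ;
  tw_line : bundleData R tw_space }.

Record is_proper_twisted (Z : twistedData) : Prop := IsProperTwisted {
  tw_hausdorff : hausdorff_space (tw_space Z) ;
  tw_locally_compact : locally_compact [set: tw_space Z] ;
  tw_s_local_homeo : local_homeomorphism (tw_s (t := Z)) ;
  tw_s_proper : proper_onto_image (tw_s (t := Z)) ;
  tw_r_continuous : continuous (tw_r (t := Z)) ;
  tw_r_proper : proper (tw_r (t := Z)) ;
  tw_line_bundle : is_hermitian_line_bundle (tw_line Z) }.

Definition twisted_iso (Z Z' : twistedData) : Prop :=
  exists phi : tw_space Z -> tw_space Z',
    [/\ homeomorphism phi,
        forall z, tw_s (phi z) = tw_s z,
        forall z, tw_r (phi z) = tw_r z &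
        bundle_iso_over phi (tw_line Z) (tw_line Z')].

(* Theta is an isomorphism of C*-correspondences E -> Gamma_0(Z, r, s, L) *)
Definition twisted_section_iso (E : correspondence R Y X) (Z : twistedData)
    (Theta : E -> forall z, fib (tw_line Z) z) : Prop :=
  [/\ injective Theta /\ range Theta = @Gamma0 R _ (tw_line Z) setT,
      forall (a : C) (xi eta : E) z,
        Theta (a *: xi + eta) z = a *: Theta xi z + Theta eta z,
      forall (xi : E) (f : C0 R X) z,
        Theta (hm_act xi f) z = f (tw_s z) *: Theta xi z,
      forall (xi eta : E) x, hm_ip xi eta x =
        \sum_(z \in tw_s (t := Z) @^-1` [set x]) fip (Theta xi z) (Theta eta z) &
      forall (g : C0 R Y) (xi : E) z,
        Theta (corr_phi g xi) z = g (tw_r z) *: Theta xi z].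

Definition twisted_associated (E : correspondence R Y X) (Z : twistedData) :
    Prop :=
  exists Theta, @twisted_section_iso E Z Theta.

Definition cartan_corresponds (E : correspondence R Y X) (Z : twistedData)
    (D : set (E -> E)) : Prop :=
  exists2 Theta, @twisted_section_iso E Z Theta &
    D = [set T | exists f : C0 R (tw_space Z),
                   forall xi z, Theta (T xi) z = f z *: Theta xi z].
End twisted.

(* Psi is an isomorphism of Hilbert C_0(X)-modules E -> Gamma_0(V), for V a
   Hermitian bundle over W *)
Definition section_iso (R : realType) (X : topologicalType)
    (E : hilbertModule R X) (W : set X) (V : bundleData R X)
    (Psi : E -> forall x, fib V x) : Prop :=
  [/\ injective Psi, range Psi = @Gamma0 R _ V W,
      forall (a : Cplx R) (xi eta : E) x,
        Psi (a *: xi + eta) x = a *: Psi xi x + Psi eta x,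
      forall (xi : E) (f : C0 R X) x, Psi (hm_act xi f) x = f x *: Psi xi x &
      forall (xi eta : E) x, hm_ip xi eta x = fip (Psi xi x) (Psi eta x)].

(* The fiber operator phi(f)_x : V_x -> V_x, i.e. phi(f)_x (xi x) = (phi f xi) x
   for xi in E ~= Gamma_0(V). *)
Definition fiber_op (R : realType) (Y X : topologicalType)
    (E : correspondence R Y X) (V : bundleData R X)
    (Psi : E -> forall x, fib V x) (f : C0 R Y) (x : X) (v : fib V x) :
    fib V x :=
  Psi (corr_phi f (xget 0 [set xi | Psi xi x = v])) x.

Section monomial.
Variable R : realType.
Local Notation C := (Cplx R).

(* A = lambda sigma, with lambda diagonal unitary and sigma : e_k |-> e_(sigma k).
   The sizes m and n are not identified definitionally because the ranks of two
   overlapping charts are only propositionally equal; the bijection forces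
   m = n. *)
Definition monomial_decomposition m n (A : 'M[C]_(m, n))
    (lambda : 'rV[C]_m) (sigma : 'I_n -> 'I_m) : Prop :=
  [/\ forall l, `|lambda 0 l| = 1, bijective sigma &
      A = diag_mx lambda *m \matrix_(l, k) (l == sigma k)%:R].

(* U(N_(D_n)) *)
Definition monomial_unitary m n (A : 'M[C]_(m, n)) : Prop :=
  exists lambda sigma, monomial_decomposition A lambda sigma.
End monomial.

Section quotient_spaces.
Variables (T : topologicalType) (S : T -> T -> Prop).

Definition generated_equiv (a b : T) : bool := `[< clos_refl_sym_trans T S a b >].

Lemma generated_equiv_refl : reflexive generated_equiv.
Proof. by move=> a; apply/asboolP; exact: rst_refl. Qed.

Lemma generated_equiv_sym : symmetric generated_equiv.
Proof. by move=> a b; apply/idP/idP => /asboolP ?; apply/asboolP; exact: rst_sym. Qed.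

Lemma generated_equiv_trans : transitive generated_equiv.
Proof.
by move=> b a c /asboolP ab /asboolP bc; apply/asboolP; exact: rst_trans bc.
Qed.

Canonical generated_equiv_rel := EquivRel generated_equiv
  generated_equiv_refl generated_equiv_sym generated_equiv_trans.

(* T modulo the equivalence relation generated by S, with the quotient
   topology *)
Definition quotient_space : topologicalType :=
  quotient_topology {eq_quot generated_equiv_rel}.

Definition class_of (a : T) : quotient_space :=
  \pi_{eq_quot generated_equiv_rel} a.

Definition class_repr (q : quotient_space) : T :=
  repr (q : {eq_quot generated_equiv_rel}).
End quotient_spaces.

Section atlases.
Variables (R : realType) (Y X : topologicalType).
Local Notation C := (Cplx R).
Variables (I : choiceType) (U : I -> set X).

Section one_atlas.
Variables (V : bundleData R X) (n : I -> nat).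
Variable h : forall (i : I) (x : X), 'cV[C]_(n i) -> fib V x.
Arguments h : clear implicits.

(* h_i^{-1}(x, .) *)
Definition frame_inv (i : I) (x : X) (w : fib V x) : 'cV[C]_(n i) :=
  xget 0 [set v | h i x v = w].

(* g_ij(x) = h_i^{-1} o h_j(x, .), as a matrix *)
Definition transition (i j : I) (x : X) : 'M[C]_(n i, n j) :=
  \matrix_(l, k) frame_inv i (h j x (delta_mx k 0)) l 0.

(* The charts h_i are only meaningful over U_i. *)
Definition is_atlas (W : set X) : Prop :=
  [/\ \bigcup_i U i = W,
      forall i, is_trivialization (U i) (h i) &
      forall i x, U i x -> forall v w : 'cV[C]_(n i),
        fip (h i x v) (h i x w) = (v ^t* *m w) 0 0].

Definition normalizing : Prop :=
  forall i j x, U i x -> U j x -> monomial_unitary (transition i j x).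

Definition diagonalizing (E : correspondence R Y X)
    (Psi : E -> forall x, fib V x) : Prop :=
  (forall i, compact (closure (U i))) /\
  forall i x, U i x -> forall (k : 'I_(n i)) (f : C0 R Y),
    exists c : C,
      fiber_op Psi f (h i x (delta_mx k 0)) = c *: h i x (delta_mx k 0).

(* xi_ik as a section of V; it vanishes outside U_i because gamma_i does *)
Definition frame_section (gamma : I -> X -> R) (i : I) (k : 'I_(n i)) :
    forall x, fib V x :=
  fun x => if x \in U i then h i x ((gamma i x)%:C%C *: delta_mx k 0) else 0.

(* \bigsqcup_i U_i x {1, ..., n_i} *)
Definition sheets : topologicalType :=
  {p : {i : I & 'I_(n i)} & set_type (U (tag p))}.

Definition sheet_pt (i : I) (k : 'I_(n i)) (x : set_type (U i)) : sheets :=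
  existT (fun p : {i : I & 'I_(n i)} => set_type (U (tag p)))
    (existT (fun i => 'I_(n i)) i k) x.

Definition sheet_chart (a : sheets) : I := tag (tag a).
Definition sheet_index (a : sheets) : 'I_(n (sheet_chart a)) := tagged (tag a).
Definition sheet_base (a : sheets) : X := set_val (tagged a).

(* (x, k, j) ~ (x, sigma_ij(x) k, i), for a = (x, k, j) and b over chart i *)
Definition sheet_glue (a b : sheets) : Prop :=
  sheet_base a = sheet_base b /\
  exists lambda sigma,
    monomial_decomposition
      (transition (sheet_chart b) (sheet_chart a) (sheet_base a)) lambda sigma /\
    sheet_index b = sigma (sheet_index a).

(* (x, k, w, j) ~ (x, sigma_ij(x) k, lambda_ij(x)_(sigma_ij(x) k) w, i) *)
Definition line_glue (a b : sheets * C) : Prop :=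
  sheet_base a.1 = sheet_base b.1 /\
  exists lambda sigma,
    [/\ monomial_decomposition
          (transition (sheet_chart b.1) (sheet_chart a.1) (sheet_base a.1))
          lambda sigma,
        sheet_index b.1 = sigma (sheet_index a.1) &
        b.2 = lambda 0 (sheet_index b.1) * a.2].

Definition atlas_space : topologicalType := quotient_space sheet_glue.

(* The fiber over q = [x, k, i] is {[x, k, w, i] : w in C}; it is identified
   with C through the representative (x, k, i) chosen by class_repr. *)
Definition atlas_line : bundleData R atlas_space :=
  @BundleData R atlas_space
    (fun _ => C^o)
    (fun _ v w => (v : C)^* * w)
    (quotient_space line_glue)
    (fun q w => class_of line_glue (class_repr q, w : C))
    (fun t => class_of sheet_glue (class_repr t).1).

Definition atlas_twisted (rho : atlas_space -> Y) : twistedData R Y X :=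
  TwistedData rho (fun q => sheet_base (class_repr q)) atlas_line.

Definition is_range_map (E : correspondence R Y X)
    (Psi : E -> forall x, fib V x) (rho : atlas_space -> Y) : Prop :=
  forall (f : C0 R Y) (i : I) (k : 'I_(n i)) (x : set_type (U i)),
    fiber_op Psi f (h i (set_val x) (delta_mx k 0)) =
    f (rho (class_of sheet_glue (sheet_pt k x))) *: h i (set_val x) (delta_mx k 0).

Definition atlas_corresponds (E : correspondence R Y X)
    (Psi : E -> forall x, fib V x) (Z : twistedData R Y X) : Prop :=
  exists2 rho, is_range_map Psi rho & twisted_iso (atlas_twisted rho) Z.
End one_atlas.

(* Equivalence of the atlases (U_i, h_i) of V and (U_i, h'_i) of V', where
   E ~= Gamma_0(V) via Psi and E' ~= Gamma_0(V') via Psi'.  As r_i(x) is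
   unitary, r_i(x)^{-1} is written as its conjugate transpose. *)
Definition atlases_equivalent (E E' : correspondence R Y X)
    (V V' : bundleData R X) (n n' : I -> nat)
    (Psi : E -> forall x, fib V x) (Psi' : E' -> forall x, fib V' x)
    (h : forall (i : I) (x : X), 'cV[C]_(n i) -> fib V x)
    (h' : forall (i : I) (x : X), 'cV[C]_(n' i) -> fib V' x) : Prop :=
  (forall x, exists m, has_dim (fib V x) m /\ has_dim (fib V' x) m) /\
  exists r : forall i : I, X -> 'M[C]_(n i, n' i),
    [/\ forall i, {within U i, continuous (r i)},
        forall i x, U i x -> monomial_unitary (r i x),
        forall i j x, U i x -> U j x ->
          transition h' i j x = (r i x) ^t* *m transition h i j x *m r j x &
        exists2 Phi : E -> E', corr_iso Phi &
          forall (xi : E) i x, U i x ->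
            Psi' (Phi xi) x =
            h' i x ((r i x) ^t* *m frame_inv h i (Psi xi x))].
End atlases.

(* Main.v *)
Require Import Defs.
From mathcomp Require Import all_boot all_order all_algebra.
From mathcomp Require Import all_classical all_reals all_analysis.
From mathcomp Require Import complex generic_quotient.
From Stdlib Require Import Relation_Operators.

Set Implicit Arguments.
Unset Strict Implicit.
Unset Printing Implicit Defensive.

Import Order.TTheory GRing.Theory Num.Theory.
Import numFieldNormedType.Exports.

Local Open Scope classical_set_scope.
Local Open Scope ring_scope.
Local Open Scope card_scope.
Local Open Scope sesquilinear_scope.

(* The fiber of Gamma_0 of Z over a point x of X is the orthogonal sum of the
   lines over the finite fiber of s.  An isomorphism of correspondences Phi
   induces unitaries between these finite dimensional spaces, and it comes from
   an isomorphism of twisted correspondences as soon as it permutes the lines,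
   that is, as soon as it maps each kernel of an evaluation into the kernel of an
   evaluation: the permutation is continuous because the nonvanishing sets of
   sections generate the topology, it commutes with r and s by linearity over
   C_0(Y) and C_0(X), and sections generate the line bundles locally.
   In (d), multiplication by a function equal to 1 at z and 0 on the rest of the
   fiber of s singles out the line over z, which gives the permutation.  For (b)
   and (c), the atlas turns Psi into an isomorphism of E with Gamma_0 of Z whose
   value at [x, k, i] is the k-th coordinate in the frame h_i, so that permuting
   the lines means mapping frame vectors to frame vectors up to phases. *)

Arguments fib {R B} _ _.
Arguments fip {R B _ x} _ _.
Arguments tot {R B} _.
Arguments pt {R B _ x} _.
Arguments pr {R B} _ _.

(** The topology of a bundle is visible only through local trivializations, and each vector has a
    fiber type indexed by its base point. Continuity is therefore phrased as convergence of the
    points [pt (sigma s)] along a filter on an arbitrary index type, with base points [b s] that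
    move with [s]; the same lemmas then serve sections over X, sections over Z and sections pulled
    back along a chart.

    The isomorphism provided by [twisted_associated] bears no relation to [Psi], so it cannot
    compare lines with frame vectors. That is why a second one is built from the atlas for (b) and
    (c), while (d) uses the one that defines the Cartan subalgebra. Only an isomorphism of twisted
    correspondences links these choices, so everything passes through (a): the cycle (a), (b), (c),
    (a), and separately (a) with (d). *)

Lemma cvg_near_ext (S : Type) (T : topologicalType) (F : set_system S) (f g : S -> T)
    (l : T) : Filter F -> (\forall s \near F, f s = g s) ->
  g @ F --> l -> f @ F --> l.
Proof.
move=> FF fg gl A /gl; rewrite /nbhs/= /nbhs/=; apply: filterS2 fg => s.
by rewrite /= => ->.
Qed.

Lemma within_continuous_cvg (S : Type) (T T' : topologicalType) (A : set T)
    (f : T -> T') (F : set_system S) (u : S -> T) (x : T) : Filter F ->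
  {within A, continuous f} -> A x -> u @ F --> x ->
  (\forall s \near F, A (u s)) -> (fun s => f (u s)) @ F --> f x.
Proof.
move=> FF /subspace_continuousP cont Ax ux Au N fN.
have := cont x Ax N fN; rewrite /nbhs/= /within/= => nA.
have := ux _ nA; move: Au; rewrite /nbhs/= /nbhs/=; apply: filterS2 => s As.
exact.
Qed.

Lemma cvg_mx_entries (T : topologicalType) m n (S : Type) (F : set_system S)
    (M : S -> 'M[T]_(m, n)) (M0 : 'M[T]_(m, n)) : Filter F ->
  (forall i j, (fun s => M s i j) @ F --> M0 i j) -> M @ F --> M0.
Proof.
move=> FF MM A [P nP PA]; rewrite /nbhs/=.
have : \forall s \near F, forall i j, P i j (M s i j).
  by apply: filter_forall => i; apply: filter_forall => j; exact: MM.
by apply: filterS => s Ps; exact: PA.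
Qed.

(** * Limits in the complex numbers and linear maps given as plain functions *)

Section complex_cvg.
Variable R : realType.
Local Notation C := (Cplx R).

Lemma cvg_conj (S : Type) (F : set_system S) (f : S -> C) (l : C) : Filter F ->
  f @ F --> l -> (fun s => (f s)^*) @ F --> l^*.
Proof.
move=> FF fl; apply/cvgrPdist_lt => eps e0.
move/cvgrPdist_lt: fl => /(_ eps e0); apply: filterS => s.
by rewrite -rmorphB norm_conjC.
Qed.

Lemma cvg_csum (S I : Type) (F : set_system S) (r : seq I) (f : I -> S -> C)
    (l : I -> C) : Filter F -> (forall i, f i @ F --> l i) ->
  (fun s => \sum_(i <- r) f i s) @ F --> \sum_(i <- r) l i.
Proof.
move=> FF fl; elim: r => [|i r IH].
  rewrite big_nil (_ : (fun s => _) = fun=> 0); first exact: cvg_cst.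
  by apply/funext => s; rewrite big_nil.
rewrite big_cons.
rewrite (_ : (fun s => _) = fun s => f i s + \sum_(j <- r) f j s).
  exact: (cvgD (fl i) IH).
by apply/funext => s; rewrite big_cons.
Qed.

(** The order on [C] compares only numbers with equal imaginary part, so positive numbers are real.
    This lets real estimates answer complex tolerances. *)
Lemma complex_gt0 (eps : C) : 0 < eps -> exists e : R, eps = e%:C%C.
Proof. by case: eps => a b; rewrite /= ltcE /= => /andP[/eqP -> _]; exists a. Qed.

Lemma cvg_complex (S : Type) (F : set_system S) (f : S -> R) (l : R) : Filter F ->
  f @ F --> l -> (fun s => (f s)%:C%C : C) @ F --> (l%:C%C : C).
Proof.
move=> FF fl; apply/cvgrPdist_lt => eps e0.
have [e er] := complex_gt0 e0.
rewrite er; rewrite er ltcR in e0.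
move/cvgrPdist_lt: fl => /(_ e e0); apply: filterS => s.
rewrite -ltcR; apply: le_lt_trans.
rewrite -rmorphB /=.
by rewrite /= normc_def /= expr0n /= addr0 sqrtr_sqr.
Qed.
End complex_cvg.

Section linear_maps.
Variables (R : realType) (U V : lmodType (Cplx R)) (f : U -> V).
Hypothesis linf : forall a v w, f (a *: v + w) = a *: f v + f w.

Lemma linear_map0 : f 0 = 0.
Proof.
have := linf 1 0 0; rewrite !scale1r addr0 => e.
by apply: (@addIr _ (f 0)); rewrite add0r -e.
Qed.

Lemma linear_mapZ a v : f (a *: v) = a *: f v.
Proof. by rewrite -[a *: v]addr0 linf linear_map0 addr0. Qed.

Lemma linear_mapD v w : f (v + w) = f v + f w.
Proof. by have := linf 1 v w; rewrite !scale1r. Qed.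

Lemma linear_map_sum (I : Type) (r : seq I) (P : pred I) (F : I -> U) :
  f (\sum_(i <- r | P i) F i) = \sum_(i <- r | P i) f (F i).
Proof. exact: (big_morph f linear_mapD linear_map0). Qed.
End linear_maps.

(** * Convergence in the total space of a Hermitian bundle *)

Section trivializations.
Variables (R : realType) (B : topologicalType) (V : bundleData R B).
Local Notation C := (Cplx R).
Variables (n : nat) (U : set B) (h : forall x, 'cV[C]_n -> fib V x).
Hypothesis tU : is_trivialization U h.
Variables (S : Type) (F : set_system S) (b : S -> B) (x0 : B).
Hypotheses (FF : Filter F) (bx0 : b @ F --> x0) (Ux0 : U x0).

Lemma triv_near : \forall s \near F, U (b s).
Proof. by case: tU => oU _ _ _; exact: (bx0 (open_nbhs_nbhs (conj oU Ux0))). Qed.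

Lemma triv_cvg (c : S -> 'cV[C]_n) (c0 : 'cV[C]_n) : c @ F --> c0 ->
  (fun s => pt (h (b s) (c s))) @ F --> pt (h x0 c0).
Proof.
move=> cc0; case: tU => oU _ _ [_ [cont _]].
apply: (@within_continuous_cvg _ _ _ _ _ F (fun s => (b s, c s)) (x0, c0) FF cont).
- by [].
- exact: (cvg_pair bx0 cc0).
- by have := triv_near; apply: filterS.
Qed.

(** The continuous inverse of the chart, followed by the second projection, recovers the coordinates
    from the points of the total space; [prK] places these points over [U]. *)
Lemma triv_coord_cvg (sigma : forall s, fib V (b s)) (v0 : fib V x0)
    (c : S -> 'cV[C]_n) (c0 : 'cV[C]_n) :
  (forall x (v : fib V x), pr V (pt v) = x) ->
  (fun s => pt (sigma s)) @ F --> pt v0 ->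
  (\forall s \near F, U (b s) -> h (b s) (c s) = sigma s) -> h x0 c0 = v0 ->
  c @ F --> c0.
Proof.
move=> prK sv hc hc0; case: tU => oU _ _ [_ [_ [g [gA fK cont]]]].
have gE x v : U x -> g (pt (h x v)) = (x, v).
  by move=> Ux; apply: (fK (x, v)); rewrite inE /=; split.
have : (fun s => g (pt (sigma s))) @ F --> (x0, c0).
  rewrite -gE// hc0; apply: (@within_continuous_cvg _ _ _ _ _ F (fun s => pt (sigma s)) (pt v0)
    FF cont) => //.
    by rewrite /= prK.
  by have := triv_near; apply: filterS => s Us /=; rewrite prK.
move=> gc; have cg : (fun s => (g (pt (sigma s))).2) @ F --> c0.
  by apply: (@cvg_comp _ _ _ _ snd _ _ _ gc); exact: cvg_snd.
apply: cvg_near_ext cg; have := triv_near; apply: filterS2 hc => s hcs Us.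
by rewrite -hcs// gE.
Qed.
End trivializations.

Section hermitian_bundles.
Variables (R : realType) (B : topologicalType) (V : bundleData R B) (W : set B).
Local Notation C := (Cplx R).
Hypothesis hV : is_hermitian_bundle V W.

Lemma fipr0 x (v : fib V x) : fip v 0 = 0.
Proof. exact: (linear_map0 (fun a w u => hb_ip_linear hV v w u a : _ = a *: _ + _)). Qed.

Lemma fiprZ x (v w : fib V x) (a : C) : fip v (a *: w) = a * fip v w.
Proof. exact: (linear_mapZ (fun a w u => hb_ip_linear hV v w u a : _ = a *: _ + _)). Qed.

Lemma fipr_sum x (v : fib V x) (I : Type) (r : seq I) (F : I -> fib V x) :
  fip v (\sum_(i <- r) F i) = \sum_(i <- r) fip v (F i).
Proof. exact: (linear_map_sum (fun a w u => hb_ip_linear hV v w u a : _ = a *: _ + _)). Qed.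

Lemma fiplZ x (v w : fib V x) (a : C) : fip (a *: v) w = a^* * fip v w.
Proof.
by rewrite (hb_ip_conj hV w) fiprZ (hb_ip_conj hV w v) -[RHS]rmorphM.
Qed.

Lemma fipl0 x (v : fib V x) : fip 0 v = 0.
Proof. by rewrite (hb_ip_conj hV v) fipr0 [LHS]rmorph0. Qed.

Lemma fipl_sum x (v : fib V x) (I : Type) (r : seq I) (F : I -> fib V x) :
  fip (\sum_(i <- r) F i) v = \sum_(i <- r) fip (F i) v.
Proof.
rewrite (hb_ip_conj hV v) fipr_sum [LHS]rmorph_sum; apply: eq_bigr => i _.
by rewrite (hb_ip_conj hV v).
Qed.

Lemma fip_eq0 x (v : fib V x) : (fip v v == 0) = (v == 0).
Proof.
by apply/eqP/eqP => [/(hb_ip_eq0 hV)//|->]; exact: fipr0.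
Qed.

Lemma cV_delta n (v : 'cV[C]_n) : v = \sum_k v k 0 *: delta_mx k 0.
Proof.
rewrite [LHS]matrix_sum_delta; apply: eq_bigr => k _.
by rewrite big_ord1.
Qed.

(** The charts of [hb_locally_trivial] need not be isometric: only their Gram entries are known to
    be continuous. Continuity of the inner product is read off this expansion. *)
Lemma fip_chart n x (h : 'cV[C]_n -> fib V x) (v w : 'cV[C]_n) :
  (forall (a : C) v w, h (a *: v + w) = a *: h v + h w) ->
  fip (h v) (h w) = \sum_k \sum_l (v k 0)^* * (w l 0) *
     fip (h (delta_mx k 0)) (h (delta_mx l 0)).
Proof.
move=> hl; rewrite {1}[v]cV_delta {1}[w]cV_delta.
rewrite (linear_map_sum hl) fipl_sum; apply: eq_bigr => k _.
rewrite (linear_map_sum hl) fipr_sum; apply: eq_bigr => l _.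
by rewrite !(linear_mapZ hl) fiplZ fiprZ mulrA.
Qed.

Variables (S : Type) (F : set_system S) (b : S -> B) (x0 : B).
Hypotheses (FF : Filter F) (bx0 : b @ F --> x0) (Wx0 : W x0).

Lemma triv_coord n (U : set B) (h : forall y, 'cV[C]_n -> fib V y)
    (sigma : forall s, fib V (b s)) : is_trivialization U h ->
  exists c : S -> 'cV[C]_n, forall s, U (b s) -> h (b s) (c s) = sigma s.
Proof.
move=> [_ _ hbij _]; suff : forall s, exists c, U (b s) -> h (b s) c = sigma s.
  by move=> hc; have [c hcE] := choice hc; exists c.
move=> s; have [Us|nUs] := pselect (U (b s)); last by exists 0.
by have [g _ gK] := hbij _ Us; exists (g (sigma s)) => _.
Qed.

Lemma fip_cvg (sigma tau : forall s, fib V (b s)) (v0 w0 : fib V x0) :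
  (fun s => pt (sigma s)) @ F --> pt v0 -> (fun s => pt (tau s)) @ F --> pt w0 ->
  (fun s => fip (sigma s) (tau s)) @ F --> fip v0 w0.
Proof.
move=> sv tw; have [n [U [h [Ux0 UW tU hip]]]] := hb_locally_trivial hV Wx0.
have [c hc] := triv_coord sigma tU; have [d hd] := triv_coord tau tU.
have [oU hlin hbij _] := tU; have [g _ gK] := hbij _ Ux0.
have cc : c @ F --> g v0.
  apply: (triv_coord_cvg tU FF bx0 Ux0 (hb_prK hV) sv) => //.
  exact: nearW.
have dd : d @ F --> g w0.
  apply: (triv_coord_cvg tU FF bx0 Ux0 (hb_prK hV) tw) => //.
  exact: nearW.
rewrite -[in fip _ _](gK v0) -[in fip _ _](gK w0).
rewrite (@fip_chart _ _ (h x0)); last exact: hlin.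
apply: (@cvg_near_ext _ _ _ _ (fun s => \sum_k \sum_l (c s k 0)^* * (d s l 0) *
     fip (h (b s) (delta_mx k 0)) (h (b s) (delta_mx l 0)))).
  have := triv_near tU bx0 Ux0; apply: filterS => s Us.
  by rewrite -hc// -hd// (@fip_chart _ _ (h (b s)))//; exact: hlin.
have entry k (e : S -> 'cV[C]_n) (e0 : 'cV[C]_n) : e @ F --> e0 ->
    (fun s => e s k 0) @ F --> e0 k 0.
  move=> ee; apply: (@cvg_comp _ _ _ e (fun M : 'cV[C]_n => M k 0) _ _ _ ee).
  exact: coord_continuous.
apply: cvg_csum => k; apply: cvg_csum => l.
apply: cvgM; first apply: cvgM.
- by apply: cvg_conj; exact: entry.
- exact: entry.
- apply: (within_continuous_cvg FF (hip _ _)) => //.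
  exact: (triv_near tU bx0 Ux0).
Qed.

Lemma scale_cvg (sigma : forall s, fib V (b s)) (v0 : fib V x0) (a : S -> C)
    (a0 : C) :
  (fun s => pt (sigma s)) @ F --> pt v0 -> a @ F --> a0 ->
  (fun s => pt (a s *: sigma s)) @ F --> pt (a0 *: v0).
Proof.
move=> sv aa; have [n [U [h [Ux0 UW tU hip]]]] := hb_locally_trivial hV Wx0.
have [c hc] := triv_coord sigma tU.
have [oU hlin hbij _] := tU; have [g _ gK] := hbij _ Ux0.
have cc : c @ F --> g v0.
  apply: (triv_coord_cvg tU FF bx0 Ux0 (hb_prK hV) sv) => //.
  exact: nearW.
rewrite -(gK v0) -(linear_mapZ (hlin _ Ux0)).
apply: (@cvg_near_ext _ _ _ _ (fun s => pt (h (b s) (a s *: c s)))).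
  have := triv_near tU bx0 Ux0; apply: filterS => s Us.
  by rewrite -hc// (linear_mapZ (hlin _ Us)).
apply: (triv_cvg tU FF bx0 Ux0); apply: cvg_mx_entries => i j.
rewrite (_ : (fun s => _) = fun s => a s * c s i j); last first.
  by apply/funext => s; rewrite mxE.
have ci : (fun s => c s i j) @ F --> g v0 i j.
  apply: (@cvg_comp _ _ _ c (fun M : 'cV[C]_n => M i j) _ _ _ cc).
  exact: coord_continuous.
rewrite (_ : (a0 *: g v0) i j = a0 * g v0 i j); last by rewrite mxE.
exact: (cvgM aa ci).
Qed.

Lemma zero_cvg : (fun s => pt (0 : fib V (b s))) @ F --> pt (0 : fib V x0).
Proof.
have [n [U [h [Ux0 UW tU hip]]]] := hb_locally_trivial hV Wx0.
have [_ hlin _ _] := tU; rewrite -(linear_map0 (hlin _ Ux0)).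
apply: (@cvg_near_ext _ _ _ _ (fun s => pt (h (b s) 0))).
  have := triv_near tU bx0 Ux0; apply: filterS => s Us.
  by rewrite (linear_map0 (hlin _ Us)).
by apply: (triv_cvg tU FF bx0 Ux0); exact: cvg_cst.
Qed.

(** In an isometric chart each coordinate is bounded by the norm, so norms tending to zero force the
    coordinates to zero. This handles a section extended by zero at the boundary of its support.
    Squares are compared, hence the tolerance [eps ^+ 2]. *)
Lemma fip0_cvg n (U : set B) (h : forall y, 'cV[C]_n -> fib V y)
    (sigma : forall s, fib V (b s)) : is_trivialization U h -> U x0 ->
  (forall x, U x -> forall v w : 'cV[C]_n, fip (h x v) (h x w) = (v ^t* *m w) 0 0) ->
  (fun s => fip (sigma s) (sigma s)) @ F --> (0 : C) ->
  (fun s => pt (sigma s)) @ F --> pt (0 : fib V x0).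
Proof.
move=> tU Ux0 iso nn; have [c hc] := triv_coord sigma tU.
have [_ hlin _ _] := tU; rewrite -(linear_map0 (hlin _ Ux0)).
apply: (@cvg_near_ext _ _ _ _ (fun s => pt (h (b s) (c s)))).
  by have := triv_near tU bx0 Ux0; apply: filterS => s Us; rewrite hc.
apply: (triv_cvg tU FF bx0 Ux0); apply: cvg_mx_entries => i j; rewrite mxE.
apply/cvgrPdist_lt => eps e0.
have e20 : 0 < eps ^+ 2 by rewrite exprn_gt0.
move/cvgrPdist_lt: nn => /(_ _ e20); have := triv_near tU bx0 Ux0.
apply: filterS2 => s Us; rewrite !sub0r !normrN -hc// iso// => lt.
rewrite -(@ltr_pXn2r _ 2)// ?nnegrE ?(ltW e0)//.
apply: le_lt_trans lt; rewrite mxE [leRHS]ger0_norm; last first.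
  by apply: sumr_ge0 => k _; rewrite !mxE -normCKC exprn_ge0.
rewrite (bigD1 i)//= !mxE -normCKC ord1 lerDl.
by apply: sumr_ge0 => k _; rewrite !mxE -normCKC exprn_ge0.
Qed.
End hermitian_bundles.

(** * Bump functions and sections with compact support *)

Section bumps.
Variables (R : realType) (T : topologicalType).
Local Notation C := (Cplx R).
Hypotheses (hT : hausdorff_space T) (lT : locally_compact [set: T]).

(** Locally compact Hausdorff spaces are completely regular, so [z] has a neighborhood [N] whose
    closure lies in [O] and in a compact set. The separating function is 0 at [z] and 1 off the
    interior of [N], whence the bump [1 - f]. *)
Lemma compact_bump (z : T) (O : set T) : open O -> O z ->
  exists (f : T -> C) (K : set T), [/\ continuous f, f z = 1,
    compact K, K `<=` O & forall y, ~ K y -> f y = 0].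
Proof.
move=> oO Oz; have [K0 nK0 [cK0 clK0]] := @lT z I.
have {}nK0 : nbhs z K0 by move: nK0; rewrite /within/=; apply: filterS => y; exact.
have crT := @locally_compact_completely_regular T R lT hT.
have nOK : nbhs z (O `&` K0) by apply: filterI => //; exact: open_nbhs_nbhs.
have [N nN NO] : filter_from (nbhs z) closure (O `&` K0).
  exact: (@completely_regular_regular R T crT z _ nOK).
have /(@uniform_separatorP T R)[f [cf _ f0 f1]] : uniform_separator [set z] (~` N°).
  by apply: crT; [apply: open_closedC; exact: open_interior|move=> /(_ nN)].
exists (fun y => (1 - f y)%:C%C), (closure N); split.
- move=> y; exact: (cvg_complex _ (cvgB (cvg_cst _) (cf y))).
- have -> : f z = 0 by apply: f0; exists z.
  by rewrite subr0.
- by apply: (subclosed_compact _ cK0); [exact: closed_closure|move=> y /NO[]].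
- by move=> y /NO[].
- move=> y nK; have -> : f y = 1; last by rewrite subrr.
  by apply: f1; exists y => //= /interior_subset/subset_closure.
Qed.

Lemma c0_bump (z : T) (O : set T) : open O -> O z ->
  exists (f : C0 R T) (K : set T),
    [/\ f z = 1, compact K, K `<=` O & forall y, ~ K y -> f y = 0].
Proof.
move=> oO Oz; have [f [K [cf fz cK KO fK]]] := compact_bump oO Oz.
have fc0 : f \in @c0_pred R T.
  rewrite inE; split=> // eps e0; exists K; split=> // y /fK ->.
  by rewrite normr0.
by exists (MkC0 fc0), K.
Qed.

Variable L : bundleData R T.
Hypothesis hL : is_hermitian_bundle L setT.

(** A bump function multiplies a section that is constant in a chart. Its support [K] is compact,
    hence closed, so every point lies either in the chart domain or in an open set where the product
    is zero. *)
Lemma section_bump (z : T) (O : set T) (v : fib L z) : open O -> O z ->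
  exists2 eta : forall y, fib L y, Gamma0 setT eta &
    eta z = v /\ forall y, ~ O y -> eta y = 0.
Proof.
move=> oO Oz; have [n [U [h [Uz _ tU _]]]] := hb_locally_trivial hL (I : [set: T] z).
have [oU hlin hbij _] := tU; have [g _ gK] := hbij _ Uz.
have [f [K [cf fz cK KO fK]]] := compact_bump (openI oO oU) (conj Oz Uz).
pose eta y : fib L y := f y *: h y (g v).
have etaK y : ~ K y -> eta y = 0 by move=> /fK; rewrite /eta => ->; rewrite scale0r.
exists eta; last first.
  split; first by rewrite /eta fz scale1r gK.
  by move=> y nO; apply: etaK => /KO[].
split; first by move=> x; case.
  apply: continuous_subspaceT => y; have [Uy|nUy] := pselect (U y).
    apply: (@scale_cvg _ _ _ _ hL _ (nbhs y) id y _ cvg_id I (fun y => h y (g v))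
      (h y (g v)) f (f y)); last exact: cf.
    exact: (@triv_cvg _ _ _ _ _ _ tU _ (nbhs y) id y _ cvg_id Uy (fun=> g v) _
      (cvg_cst _)).
  have nKy : nbhs y (~` K).
    apply: open_nbhs_nbhs; split.
      by apply: closed_openC; exact: compact_closed.
    by move=> /KO[].
  suff : (fun s => pt (eta s)) @ y --> pt (eta y) by [].
  rewrite [eta y]etaK; last exact: nbhs_singleton nKy.
  apply: (@cvg_near_ext _ _ _ _ (fun y => pt (0 : fib L y))).
    by apply: filterS nKy => x /etaK ->.
  exact: (@zero_cvg _ _ _ _ hL _ (nbhs y) id y _ cvg_id I).
move=> eps e0; exists K; split=> // y /etaK ->.
by rewrite (fipr0 hL) sqrtC0.
Qed.
End bumps.

Lemma Gamma0_cvg (R : realType) (B : topologicalType) (V : bundleData R B)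
    (W : set B) (eta : forall x, fib V x) (S : Type) (F : set_system S)
    (b : S -> B) (x : B) : open W -> Filter F -> Gamma0 W eta -> W x ->
  b @ F --> x -> (fun s => pt (eta (b s))) @ F --> pt (eta x).
Proof.
move=> oW FF [_ cont _] Wx bx.
apply: (@within_continuous_cvg _ _ _ _ _ F b x FF cont) => //.
exact: (bx _ (open_nbhs_nbhs (conj oW Wx))).
Qed.

Lemma line_scalar (R : realType) (L : lmodType (Cplx R)) (v w : L) :
  has_dim L 1 -> v != 0 -> exists c : Cplx R, w = c *: v.
Proof.
move=> [h [hlin [g gK hK]]] v0.
have E u : u = (g u 0 0) *: h (const_mx 1).
  rewrite -(linear_mapZ hlin) -[LHS]hK; congr h.
  by apply/matrixP => i j; rewrite !mxE !ord1 mulr1.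
have gv0 : g v 0 0 != 0.
  by apply: contra v0 => /eqP gv; rewrite [v]E gv scale0r.
exists (g w 0 0 / g v 0 0).
by rewrite {2}[v]E scalerA divfK// -E.
Qed.

(** * Evaluation of elements of E on the lines over Z *)

Section local_homeomorphisms.
Variables (S T : topologicalType) (s : S -> T).
Hypothesis hs : local_homeomorphism s.

Lemma local_homeomorphism_continuous : continuous s.
Proof.
move=> z; have [N [oN Nz _ [_ [cs _]]]] := hs z.
apply: (@within_continuous_cvg _ _ _ _ _ (nbhs z) id z _ cs) => //.
exact: open_nbhs_nbhs.
Qed.

Lemma local_homeomorphism_inj z :
  exists O, [/\ open O, O z & forall y y', O y -> O y' -> s y = s y' -> y = y'].
Proof.
have [N [oN Nz _ [[_ inj _] _]]] := hs z; exists N; split=> // y y' Ny Ny'.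
by apply: inj; rewrite inE.
Qed.
End local_homeomorphisms.

Section section_isos.
Variables (R : realType) (Y X : topologicalType).
Local Notation C := (Cplx R).
Variables (E : correspondence R Y X) (Z : twistedData R Y X).
Variable Theta : E -> forall z, fib (tw_line Z) z.
Hypotheses (hZ : is_proper_twisted Z) (hT : twisted_section_iso Theta).
Hypothesis fin : forall x, finite_set (tw_s (t := Z) @^-1` [set x]).

Lemma line_hermitian : is_hermitian_bundle (tw_line Z) setT.
Proof. by case: (tw_line_bundle hZ). Qed.

Lemma line_dim z : has_dim (fib (tw_line Z) z) 1.
Proof. by case: (tw_line_bundle hZ). Qed.

Lemma theta_Gamma0 xi : Gamma0 setT (Theta xi).
Proof. by case: hT => -[_ <-] _ _ _ _; exists xi. Qed.

Lemma theta_surj eta : Gamma0 setT eta -> exists xi, Theta xi = eta.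
Proof. by case: hT => -[_ <-] _ _ _ _ [xi _ <-]; exists xi. Qed.

Lemma theta_linear (a : C) (xi eta : E) z :
  Theta (a *: xi + eta) z = a *: Theta xi z + Theta eta z.
Proof. by case: hT. Qed.

Lemma theta_cvg xi (S : Type) (F : set_system S) (b : S -> tw_space Z) z :
  Filter F -> b @ F --> z -> (fun s => pt (Theta xi (b s))) @ F --> pt (Theta xi z).
Proof.
move=> FF bz; exact: (Gamma0_cvg openT FF (theta_Gamma0 xi) (I : [set: _] z) bz).
Qed.

Lemma theta_bump z (O : set (tw_space Z)) (v : fib (tw_line Z) z) :
  open O -> O z -> exists xi, Theta xi z = v /\ forall y, ~ O y -> Theta xi y = 0.
Proof.
move=> oO Oz; have [eta + [etaz etaO]] := section_bump (tw_hausdorff hZ)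
  (tw_locally_compact hZ) line_hermitian v oO Oz.
by move=> /theta_surj[xi xiE]; exists xi; rewrite xiE.
Qed.

(** Where [tw_s] is injective, [z] is alone in its fiber, so a bump supported there vanishes on the
    rest of the fiber. *)
Lemma theta_fiber_bump z (v : fib (tw_line Z) z) :
  exists xi, Theta xi z = v /\
    forall y, tw_s y = tw_s z -> y <> z -> Theta xi y = 0.
Proof.
have [N [oN Nz inj]] := local_homeomorphism_inj (tw_s_local_homeo hZ) z.
have [xi [xiz xiO]] := theta_bump v oN Nz; exists xi; split=> // y sy yz.
by apply: xiO => Ny; apply: yz; exact: inj.
Qed.

Lemma line_neq0 z : exists v : fib (tw_line Z) z, v != 0.
Proof.
have [h [hlin hbij]] := line_dim z; exists (h (const_mx 1)).
have [g hK _] := hbij; apply/eqP => h0.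
have := linear_map0 hlin; rewrite -h0 => /(congr1 g); rewrite !hK.
by move=> /matrixP/(_ 0 0); rewrite !mxE => /eqP; rewrite eq_sym oner_eq0.
Qed.

Lemma theta_ipE (xi eta : E) x : hm_ip xi eta x =
  \sum_(z \in tw_s (t := Z) @^-1` [set x]) fip (Theta xi z) (Theta eta z).
Proof. by case: hT. Qed.

(** This reads the inner product of a single line off the module inner product, which is the one
    that [Phi] preserves. *)
Lemma theta_ip1 (xi eta : E) z :
  (forall y, tw_s y = tw_s z -> y <> z -> Theta xi y = 0) ->
  hm_ip xi eta (tw_s z) = fip (Theta xi z) (Theta eta z).
Proof.
move=> xi0; rewrite theta_ipE -(@fsbig_set1 _ _ +%R _ z
  (fun y => fip (Theta xi y) (Theta eta y))).
apply/esym/fsbig_widen; first by move=> y ->.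
by move=> y [/= sy yz]; rewrite xi0//; exact: (fipl0 line_hermitian).
Qed.

(** A sum of nonnegative terms is zero only if each term is. Finiteness of the fiber enters here,
    because a sum with infinite support is 0 by convention. *)
Lemma theta_ip0 (xi : E) x :
  hm_ip xi xi x = 0 <-> forall z, tw_s z = x -> Theta xi z = 0.
Proof.
rewrite theta_ipE fsbig_finite//; split=> [|xi0]; last first.
  rewrite big1_seq// => z /=; rewrite in_fset_set// inE/= => /xi0 ->.
  exact: (fipr0 line_hermitian).
move=> /eqP; rewrite psumr_eq0; last by move=> z _; exact: (hb_ip_ge0 line_hermitian).
move=> /allP xi0 z sz; apply/eqP; rewrite -(fip_eq0 line_hermitian).
by apply: xi0; rewrite in_fset_set// inE.
Qed.
End section_isos.

(** * Isomorphisms of correspondences that permute the lines *)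

Lemma inj_surj_bijective (S T : Type) (f : S -> T) :
  injective f -> (forall y, exists x, f x = y) -> bijective f.
Proof.
move=> inj surj; pose g y := sval (cid (surj y)).
have gK y : f (g y) = y by exact: (svalP (cid (surj y))).
by exists g => // x; apply: inj.
Qed.

Lemma corr_iso_inv (R : realType) (Y X : topologicalType)
    (E E' : correspondence R Y X) (Phi : E -> E') (Phi' : E' -> E) :
  corr_iso Phi -> cancel Phi Phi' -> cancel Phi' Phi -> corr_iso Phi'.
Proof.
move=> [_ lin act ip phi] K K'; have inj := can_inj K; split.
- by exists Phi.
- by move=> a xi eta; apply: inj; rewrite lin !K'.
- by move=> xi f; apply: inj; rewrite act !K'.
- by move=> xi eta; rewrite -ip !K'.
- by move=> f xi; apply: inj; rewrite phi !K'.
Qed.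

Section morphisms.
Variables (R : realType) (Y X : topologicalType).
Local Notation C := (Cplx R).
Variables (E E' : correspondence R Y X) (Z Z' : twistedData R Y X).
Variable Theta : E -> forall z, fib (tw_line Z) z.
Variable Theta' : E' -> forall z, fib (tw_line Z') z.
Hypotheses (hZ : is_proper_twisted Z) (hT : twisted_section_iso Theta).
Hypotheses (hZ' : is_proper_twisted Z') (hT' : twisted_section_iso Theta').
Variables (Phi : E -> E') (phi : tw_space Z -> tw_space Z').
Hypothesis isoPhi : corr_iso Phi.
Hypothesis ker : forall z xi, Theta xi z = 0 <-> Theta' (Phi xi) (phi z) = 0.

Lemma ker_linear (a : C) (xi eta : E) z : Theta' (Phi (a *: xi + eta)) z =
  a *: Theta' (Phi xi) z + Theta' (Phi eta) z.
Proof. by have [_ -> _ _ _] := isoPhi; rewrite (theta_linear hT'). Qed.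

Lemma ker_surj z (v : fib (tw_line Z') z) (O : set (tw_space Z')) :
  open O -> O z ->
  exists xi, Theta' (Phi xi) z = v /\ forall y, ~ O y -> Theta' (Phi xi) y = 0.
Proof.
move=> oO Oz; have [[Psi _ PsiK] _ _ _ _] := isoPhi.
have [eta etaP] := theta_bump hZ' hT' v oO Oz.
by exists (Psi eta); rewrite PsiK.
Qed.

Lemma theta_neq0_nbhs xi z : Theta xi z != 0 ->
  nbhs z [set y | Theta xi y != 0].
Proof.
move=> xiz; have hL := line_hermitian hZ.
have cv := theta_cvg hT (nbhs_filter z) (@cvg_id _ (nbhs z)) (xi := xi).
have := @fip_cvg _ _ _ _ hL _ (nbhs z) id z (nbhs_filter z) cvg_id I _ _ _ _ cv cv.
move/cvgrPdist_lt/(_ `|fip (Theta xi z) (Theta xi z)|).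
rewrite normr_gt0 (fip_eq0 hL) => /(_ xiz); apply: filterS => y /=.
by apply: contraTneq => ->; rewrite (fipr0 hL) subr0 ltxx.
Qed.

(** Take an element whose image is supported in a given neighborhood of [phi z] and nonzero at
    [phi z]. By [ker] it is nonzero at [z], hence near [z], and wherever it is nonzero [phi] takes
    values in that neighborhood. *)
Lemma ker_continuous : continuous phi.
Proof.
move=> z N; rewrite nbhsE => -[G [oG Gz] GN].
have [v v0] := line_neq0 hZ' (phi z).
have [xi [xiz xiG]] := ker_surj v oG Gz.
have : Theta xi z != 0 by apply: contra v0 => /eqP/ker; rewrite xiz => ->.
move/(theta_neq0_nbhs); rewrite /nbhs/=; apply: filterS => y /= xiy; apply: GN.
by apply: contrapT => /xiG/ker xiy0; rewrite xiy0 eqxx in xiy.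
Qed.

(** Two elements with the same value at [z] differ by one in the kernel at [z], so the value of the
    image at [phi z] depends only on the value at [z]. *)
Lemma ker_fiber_map z : exists u : fib (tw_line Z) z -> fib (tw_line Z') (phi z),
  forall xi, u (Theta xi z) = Theta' (Phi xi) (phi z).
Proof.
suff : forall v, exists w, forall xi, Theta xi z = v -> Theta' (Phi xi) (phi z) = w.
  by move=> /choice[u uE]; exists u; move=> xi; rewrite (uE _ xi erefl).
move=> v; have [xi [xiz _]] := theta_bump hZ hT v openT (I : [set: _] z).
exists (Theta' (Phi xi) (phi z)) => eta etaz.
apply/eqP; rewrite -subr_eq0; apply/eqP.
rewrite -[LHS]addrC -scaleN1r -ker_linear; apply/ker.
by rewrite (theta_linear hT) xiz etaz scaleN1r addNr.
Qed.

Lemma ker_fiber_maps :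
  exists u : forall z, fib (tw_line Z) z -> fib (tw_line Z') (phi z),
  forall z xi, u z (Theta xi z) = Theta' (Phi xi) (phi z).
Proof.
by exists (fun z => sval (cid (ker_fiber_map z))) => z;
  exact: (svalP (cid (ker_fiber_map z))).
Qed.

Lemma theta_at z (v : fib (tw_line Z) z) : exists xi, Theta xi z = v.
Proof.
by have [xi [<- _]] := theta_bump hZ hT v openT (I : [set: _] z); exists xi.
Qed.

(** Near [t], choose [xi] nonzero at the base point. Every nearby vector is [c t] times the value of
    [xi], where [c] is a quotient of inner products and hence continuous, and [F] maps it to [c t]
    times the value of [Phi xi]. *)
Lemma ker_total_map : exists F : tot (tw_line Z) -> tot (tw_line Z'),
  continuous F /\ forall xi z, F (pt (Theta xi z)) = pt (Theta' (Phi xi) (phi z)).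
Proof.
have hL := line_hermitian hZ; have hL' := line_hermitian hZ'.
have [u uE] := ker_fiber_maps.
have uZ z a v : u z (a *: v) = a *: u z v.
  have [xi <-] := theta_at v; have [eta etaE] := theta_at (a *: Theta xi z).
  rewrite -etaE !uE; apply/eqP; rewrite -subr_eq0; apply/eqP.
  rewrite addrC -scaleNr -ker_linear; apply/ker.
  by rewrite (theta_linear hT) etaE scaleNr addNr.
pose vt t := sval (cid (hb_pt_surj hL t)).
have vtE t : pt (vt t) = t by exact: (svalP (cid (hb_pt_surj hL t))).
pose F t := pt (u (pr (tw_line Z) t) (vt t)).
have FE z v : F (pt v) = pt (u z v).
  (* The fiber of [vt (pt v)] is indexed by [pr (pt v)], which equals [z] only propositionally; it
     is generalized before the index is rewritten. *)
  rewrite /F; move: (vtE (pt v)); move: (vt (pt v)); rewrite (hb_prK hL) => w.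
  by move=> /(hb_pt_inj hL) ->.
exists F; split=> [t|xi z]; last by rewrite FE uE.
have prc : pr (tw_line Z) @ t --> pr (tw_line Z) t.
  apply: (@within_continuous_cvg _ _ _ _ _ (nbhs t) id t _ (hb_pr_continuous hL)) => //.
  exact: nearW.
have [w w0] := line_neq0 hZ (pr (tw_line Z) t).
have [xi xiE] := theta_at w; rewrite -xiE in w0.
pose b := pr (tw_line Z).
have xic : (fun t => pt (Theta xi (b t))) @ t --> pt (Theta xi (b t)).
  exact: (theta_cvg hT _ prc).
have vtc : (fun t => pt (vt t)) @ t --> pt (vt t).
  rewrite vtE (_ : (fun t => pt (vt t)) = id); first exact: cvg_id.
  exact: (funext vtE).
pose c t := fip (Theta xi (b t)) (vt t) / fip (Theta xi (b t)) (Theta xi (b t)).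
have n0 : fip (Theta xi (b t)) (Theta xi (b t)) != 0 by rewrite (fip_eq0 hL).
have cE t' : Theta xi (b t') != 0 -> vt t' = c t' *: Theta xi (b t').
  move=> xi0; have [d dE] := line_scalar (vt t') (line_dim hZ (b t')) xi0.
  by rewrite /c dE (fiprZ hL) mulfK// (fip_eq0 hL).
have cc : c @ t --> c t.
  apply: cvgM.
    exact: (@fip_cvg _ _ _ _ hL _ (nbhs t) b (b t) _ prc I _ _ _ _ xic vtc).
  apply: cvgV => //.
  exact: (@fip_cvg _ _ _ _ hL _ (nbhs t) b (b t) _ prc I _ _ _ _ xic xic).
have Fc t' : Theta xi (b t') != 0 -> F t' = pt (c t' *: Theta' (Phi xi) (phi (b t'))).
  by move=> xi0; rewrite /F cE// uZ uE.
suff : F @ t --> F t by [].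
rewrite (Fc t w0).
apply: (@cvg_near_ext _ _ _ _ (fun t => pt (c t *: Theta' (Phi xi) (phi (b t))))).
  have : nbhs t (b @^-1` [set y | Theta xi y != 0]).
    exact: (prc _ (theta_neq0_nbhs w0)).
  by apply: filterS => t'; exact: Fc.
have phib : (fun t => phi (b t)) @ t --> phi (b t).
  exact: (@cvg_comp _ _ _ b phi _ _ _ prc (@ker_continuous (b t))).
apply: (@scale_cvg _ _ _ _ hL' _ (nbhs t) (fun t => phi (b t)) (phi (b t)) _ phib I
  (fun t => Theta' (Phi xi) (phi (b t)))) => //.
exact: (theta_cvg hT' _ phib).
Qed.

Lemma ker_fiber_linear (u : forall z, fib (tw_line Z) z -> fib (tw_line Z') (phi z)) :
  (forall z xi, u z (Theta xi z) = Theta' (Phi xi) (phi z)) ->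
  (forall z (a : C) v w, u z (a *: v + w) = a *: u z v + u z w) /\
  forall z, bijective (u z).
Proof.
move=> uE; split=> [z a v w|z].
  have [xi <-] := theta_at v; have [eta <-] := theta_at w.
  by rewrite -(theta_linear hT) !uE ker_linear.
apply: inj_surj_bijective.
  move=> v w; have [xi <-] := theta_at v; have [eta <-] := theta_at w.
  rewrite !uE => e; apply/eqP; rewrite -subr_eq0 addrC -scaleN1r.
  rewrite -(theta_linear hT); apply/eqP/ker.
  by rewrite ker_linear e scaleN1r addNr.
move=> w; have [xi [<- _]] := ker_surj w openT (I : [set: _] (phi z)).
by exists (Theta xi z).
Qed.
End morphisms.

Section kernel_relation.
Variables (R : realType) (Y X : topologicalType).
Local Notation C := (Cplx R).
Hypotheses (hX : hausdorff_space X) (lX : locally_compact [set: X]).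
Hypotheses (hY : hausdorff_space Y) (lY : locally_compact [set: Y]).
Variables (E E' : correspondence R Y X) (Z Z' : twistedData R Y X).
Variable Theta : E -> forall z, fib (tw_line Z) z.
Variable Theta' : E' -> forall z, fib (tw_line Z') z.
Hypotheses (hZ : is_proper_twisted Z) (hT : twisted_section_iso Theta).
Hypotheses (hZ' : is_proper_twisted Z') (hT' : twisted_section_iso Theta').
Hypothesis fin : forall x, finite_set (tw_s (t := Z) @^-1` [set x]).
Hypothesis fin' : forall x, finite_set (tw_s (t := Z') @^-1` [set x]).
Variable Phi : E -> E'.
Hypothesis isoPhi : corr_iso Phi.

Lemma c0_separates (T : topologicalType) (x y : T) : hausdorff_space T ->
  locally_compact [set: T] -> (forall f : C0 R T, f x = f y) -> x = y.
Proof.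
move=> hT0 lT0 fxy; apply: contrapT => xy.
have o : open (~` [set y]).
  by apply: closed_openC; exact/accessible_closed_set1/hausdorff_accessible.
have [f [K [fx _ KO fK]]] := @c0_bump R T hT0 lT0 x _ o xy.
have := fxy f; rewrite fx (fK y); last by move=> /KO /(_ erefl).
by move=> /eqP; rewrite oner_eq0.
Qed.

(* The kernels of evaluation at a point of a line have codimension one, so an
   inclusion between two of them is an equality. *)
Lemma ker_sub_eq z z' :
  (forall xi, Theta xi z = 0 -> Theta' (Phi xi) z' = 0) ->
  forall xi, Theta xi z = 0 <-> Theta' (Phi xi) z' = 0.
Proof.
move=> sub xi; split; first exact: sub.
move=> xiz'; apply/eqP/negPn/negP => xiz.
have [w w0] := line_neq0 hZ' z'.
have [eta [etaE _]] := ker_surj hZ' hT' isoPhi w openT (I : [set: _] z').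
have [c cE] := line_scalar (Theta eta z) (line_dim hZ z) xiz.
have := sub (- c *: xi + eta); rewrite (theta_linear hT) cE scaleNr addNr.
move/(_ erefl); rewrite (ker_linear hT' isoPhi) xiz' scaler0 add0r etaE => w00.
by rewrite w00 eqxx in w0.
Qed.

(** Both (c) and (d) lead to (a) through this criterion. It asks for one inclusion of kernels at
    each point; the choice of [z'] becomes the homeomorphism. *)
Lemma kernel_relation_twisted_iso :
  (forall z, exists z', forall xi, Theta xi z = 0 -> Theta' (Phi xi) z' = 0) ->
  twisted_iso Z Z'.
Proof.
move=> rel; have [phi phiP] := choice rel.
have ker z := ker_sub_eq (phiP z).
have hL := line_hermitian hZ; have hL' := line_hermitian hZ'.
have [_ lin act ip corr] := isoPhi.
have nz z : exists2 xi, Theta xi z != 0 & Theta' (Phi xi) (phi z) != 0.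
  have [w w0] := line_neq0 hZ z; have [xi xiE] := theta_at hZ hT w.
  exists xi; rewrite ?xiE//; apply: contra w0 => /eqP/ker.
  by rewrite xiE => ->.
have actE xi f z : Theta (hm_act xi f) z = f (tw_s z) *: Theta xi z by case: hT.
have actE' xi f z : Theta' (hm_act xi f) z = f (tw_s z) *: Theta' xi z by case: hT'.
have corE f xi z : Theta (corr_phi f xi) z = f (tw_r z) *: Theta xi z by case: hT.
have corE' f xi z : Theta' (corr_phi f xi) z = f (tw_r z) *: Theta' xi z by case: hT'.
(* Multiplying [xi] by [f] and subtracting [f (tw_s z)] times [xi] gives an element vanishing at
   [z]; its image vanishes at [phi z], where the scalar is [f (tw_s (phi z)) - f (tw_s z)].
   Functions in C_0(X) separate points. *)
have sphi z : tw_s (phi z) = tw_s z.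
  apply: c0_separates => // f; have [xi _ n0] := nz z.
  have /ker : Theta (- f (tw_s z) *: xi + hm_act xi f) z = 0.
    by rewrite (theta_linear hT) actE scaleNr addNr.
  rewrite (ker_linear hT' isoPhi) act actE' -scalerDl => /eqP.
  by rewrite scaler_eq0 (negPf n0) orbF addrC subr_eq0 => /eqP.
have rphi z : tw_r (phi z) = tw_r z.
  apply: c0_separates => // f; have [xi _ n0] := nz z.
  have /ker : Theta (- f (tw_r z) *: xi + corr_phi f xi) z = 0.
    by rewrite (theta_linear hT) corE scaleNr addNr.
  rewrite (ker_linear hT' isoPhi) corr corE' -scalerDl => /eqP.
  by rewrite scaler_eq0 (negPf n0) orbF addrC subr_eq0 => /eqP.
have phi_inj : injective phi.
  move=> z1 z2 e; apply: contrapT => z12.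
  have [w w0] := line_neq0 hZ z1.
  have o : open (~` [set z2]).
    apply: closed_openC; apply: accessible_closed_set1.
    exact/hausdorff_accessible/(tw_hausdorff hZ).
  have [xi [xi1 xi2]] := theta_bump hZ hT w o z12.
  have /ker : Theta xi z2 = 0 by apply: xi2 => /(_ erefl).
  by rewrite -e => /ker; rewrite xi1 => w00; rewrite w00 eqxx in w0.
(* If [z'] is missed, let [eta] be nonzero at [z'] and zero on the rest of its fiber. The preimage
   of [eta] vanishes on the whole fiber over [tw_s z'], so its norm there is zero, and [Phi]
   preserves that norm. *)
have phi_surj z' : exists z, phi z = z'.
  apply: contrapT => nex; have [w w0] := line_neq0 hZ' z'.
  have [eta [etaz' eta0]] := theta_fiber_bump hZ' hT' w.
  have [[Psi _ PsiK] _ _ _ _] := isoPhi.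
  have : hm_ip eta eta (tw_s z') = 0.
    rewrite -[eta]PsiK ip; apply/(theta_ip0 hZ hT fin) => z sz.
    apply/ker; rewrite PsiK; apply: eta0; rewrite ?sphi//.
    by move=> phiz; apply: nex; exists z.
  move/(theta_ip0 hZ' hT' fin')/(_ z' erefl); rewrite etaz' => w00.
  by rewrite w00 eqxx in w0.
have [phi' phiK phiK'] := inj_surj_bijective phi_inj phi_surj.
have [[Phi' PhiK PhiK'] _ _ _ _] := isoPhi.
have isoPhi' := corr_iso_inv isoPhi PhiK PhiK'.
(* With the equivalence of kernels for the inverse maps, the continuity results apply in both
   directions. *)
have ker' z xi : Theta' xi z = 0 <-> Theta (Phi' xi) (phi' z) = 0.
  by have := ker (phi' z) (Phi' xi); rewrite PhiK' phiK' => k; split=> /k.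
have [u uE] := ker_fiber_maps hZ hT hT' isoPhi ker.
have [ulin ubij] := ker_fiber_linear hZ hT hZ' hT' isoPhi ker uE.
have homeoT (S T : topologicalType) (f : S -> T) (g : T -> S) :
    continuous f -> continuous g -> cancel f g -> cancel g f -> homeomorphism f.
  move=> cf cg fK gK; split; first by rewrite setTT_bijective; exists g.
  split; first exact: continuous_subspaceT.
  by exists g; split=> //; exact: continuous_subspaceT.
exists phi; split=> //.
  apply: homeoT phiK phiK'.
    exact: (ker_continuous hZ hT hZ' hT' isoPhi ker).
  exact: (ker_continuous hZ' hT' hZ hT isoPhi' ker').
exists u; split=> //.
  move=> z v w.
  (* As [xi] lives on one line of the fiber, and so does its image, both module inner products
     reduce to a single term. *)
  have [xi [xiz xi0]] := theta_fiber_bump hZ hT v.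
  have [eta <-] := theta_at hZ hT w.
  rewrite -xiz !uE -(theta_ip1 hZ hT)// -(theta_ip1 hZ' hT'); last first.
    move=> y' sy' yz; rewrite -[y']phiK'; apply/ker; apply: xi0.
      by rewrite -sphi phiK' sy' sphi.
    by move=> e; apply: yz; rewrite -e phiK'.
  by rewrite ip sphi.
have [F [Fc FE]] := ker_total_map hZ hT hZ' hT' isoPhi ker.
have [F' [Fc' FE']] := ker_total_map hZ' hT' hZ hT isoPhi' ker'.
exists F; split; last first.
  by move=> z v; have [xi <-] := theta_at hZ hT v; rewrite FE uE.
apply: homeoT Fc Fc' _ _ => t.
  have [v <-] := hb_pt_surj hL t; have [xi <-] := theta_at hZ hT v.
  by rewrite FE FE' PhiK phiK.
have [v <-] := hb_pt_surj hL' t; have [xi <-] := theta_at hZ' hT' v.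
by rewrite FE' FE PhiK' phiK'.
Qed.
End kernel_relation.

(** * From isomorphisms of twisted correspondences to isomorphisms of correspondences *)

Lemma homeomorphism_inverse (S T : topologicalType) (f : S -> T) :
  homeomorphism f -> exists g : T -> S,
    [/\ continuous f, continuous g, cancel f g & cancel g f].
Proof.
move=> [bij [cf [g [_ fK cg]]]]; exists g.
have {}fK : cancel f g by move=> x; apply: fK; rewrite inE.
move: bij; rewrite setTT_bijective => -[g' _ gK'].
split=> //; try exact/continuous_subspace_setT.
by move=> y; rewrite -[y]gK' fK.
Qed.

Lemma c0_comp (R : realType) (S T : topologicalType) (f : S -> T) (g : T -> S)
    (a : C0 R S) : continuous f -> continuous g -> cancel g f ->
  exists b : C0 R T, forall x, b x = a (g x).
Proof.
move=> cf cg gK; case: a => a /=; rewrite inE => -[ca va].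
have b0 : (fun x => a (g x)) \in @c0_pred R T.
  rewrite inE; split=> [x|eps e0].
    exact: (@cvg_comp _ _ _ g a _ _ _ (cg x) (ca (g x))).
  have [K [cK aK]] := va eps e0; exists (f @` K); split.
    by apply: continuous_compact => //; exact: continuous_subspaceT.
  by move=> x nx; apply: aK => Kg; apply: nx; exists (g x).
by exists (MkC0 b0).
Qed.

Section twisted_isos.
Variables (R : realType) (Y X : topologicalType).
Local Notation C := (Cplx R).
Variables (E E' : correspondence R Y X) (Z Z' : twistedData R Y X).
Variable Theta : E -> forall z, fib (tw_line Z) z.
Variable Theta' : E' -> forall z, fib (tw_line Z') z.
Hypotheses (hZ : is_proper_twisted Z) (hT : twisted_section_iso Theta).
Hypotheses (hZ' : is_proper_twisted Z') (hT' : twisted_section_iso Theta').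

(** Sections are transported by [u] over [phi]. The maps on points and lines are returned with
    [Phi], since (b) and (d) need to know what [Phi] does on each line. *)
Lemma twisted_iso_corr_iso : twisted_iso Z Z' ->
  exists (phi : tw_space Z -> tw_space Z') (psi : tw_space Z' -> tw_space Z)
         (u : forall z, fib (tw_line Z) z -> fib (tw_line Z') (phi z))
         (Phi : E -> E'),
    [/\ [/\ continuous phi, continuous psi, cancel phi psi & cancel psi phi],
        forall z, tw_s (phi z) = tw_s z,
        forall z (a : C) v w, u z (a *: v + w) = a *: u z v + u z w,
        forall z, injective (u z) &
        corr_iso Phi /\ forall xi z, Theta' (Phi xi) (phi z) = u z (Theta xi z)].
Proof.
move=> [phi [/homeomorphism_inverse[psi [cphi cpsi phiK psiK]] sphi rphi]].
move=> [u [ulin ubij uip [F [/homeomorphism_inverse[G [cF cG FK GK]] FE]]]].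
have hL := line_hermitian hZ; have hL' := line_hermitian hZ'.
have push xi : exists xi', forall z, Theta' xi' (phi z) = u z (Theta xi z).
  (* The transported vector lies over [phi (psi z')] instead of [z']; the two fibers are compared
     through points of the total space. *)
  have move_fib (z' z'' : tw_space Z') (v : fib (tw_line Z') z') :
      z' = z'' -> exists w : fib (tw_line Z') z'', pt w = pt v.
    by move=> <-; exists v.
  have [eta etaE] : exists eta : forall z', fib (tw_line Z') z',
      forall z', pt (eta z') = pt (u (psi z') (Theta xi (psi z'))).
    pose w z' := cid (move_fib _ _ (u (psi z') (Theta xi (psi z'))) (psiK z')).
    by exists (fun z' => sval (w z')) => z'; exact: (svalP (w z')).
  have etaphi z : eta (phi z) = u z (Theta xi z).
    by apply: (hb_pt_inj hL'); rewrite etaE phiK.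
  suff /(theta_surj hT')[xi' xi'E] : Gamma0 setT eta.
    by exists xi' => z; rewrite xi'E.
  split; first by move=> z; case.
    apply: continuous_subspaceT => z'.
    have -> : (fun x => pt (eta x)) = fun x => F (pt (Theta xi (psi x))).
      by apply/funext => x; rewrite etaE FE.
    apply: (@cvg_comp _ _ _ (fun x => pt (Theta xi (psi x))) F); last exact: cF.
    exact: (theta_cvg hT (nbhs_filter z') (cpsi z')).
  move=> eps e0; have [_ _ /(_ eps e0)[K [cK _ xiK]]] := theta_Gamma0 hT xi.
  exists (phi @` K); split=> //.
    by apply: continuous_compact => //; exact: continuous_subspaceT.
  move=> z' nz'; rewrite -[z']psiK etaphi uip; apply: xiK => Kz.
  by apply: nz'; exists (psi z').
have pull xi' : exists xi, forall z, Theta' xi' (phi z) = u z (Theta xi z).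
  have [eta etaE] : exists eta : forall z, fib (tw_line Z) z,
      forall z, u z (eta z) = Theta' xi' (phi z).
    have surj z : exists v, u z v = Theta' xi' (phi z).
      by have [g _ gK] := ubij z; exists (g (Theta' xi' (phi z))).
    by exists (fun z => sval (cid (surj z))) => z; exact: (svalP (cid (surj z))).
  suff /(theta_surj hT)[xi xiE] : Gamma0 setT eta.
    by exists xi => z; rewrite xiE.
  split; first by move=> z; case.
    apply: continuous_subspaceT => z.
    have -> : (fun x => pt (eta x)) = fun x => G (pt (Theta' xi' (phi x))).
      by apply/funext => x; rewrite -etaE -FE FK.
    apply: (@cvg_comp _ _ _ (fun x => pt (Theta' xi' (phi x))) G); last exact: cG.
    exact: (theta_cvg hT' (nbhs_filter z) (cphi z)).
  move=> eps e0; have [_ _ /(_ eps e0)[K [cK _ xiK]]] := theta_Gamma0 hT' xi'.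
  exists (psi @` K); split=> //.
    by apply: continuous_compact => //; exact: continuous_subspaceT.
  move=> z nz; rewrite -uip etaE; apply: xiK => Kz.
  by apply: nz; exists (phi z); rewrite ?phiK.
have [Phi PhiE] := choice push.
have ext' (xi eta : E') :
    (forall z, Theta' xi (phi z) = Theta' eta (phi z)) -> xi = eta.
  move=> e; have [[inj _] _ _ _ _] := hT'; apply: inj.
  by apply: functional_extensionality_dep => z'; rewrite -[z']psiK.
have ext (xi eta : E) : (forall z, Theta xi z = Theta eta z) -> xi = eta.
  move=> e; have [[inj _] _ _ _ _] := hT; apply: inj.
  exact: functional_extensionality_dep.
have uinj z : injective (u z) by exact: bij_inj (ubij z).
exists phi, psi, u, Phi; split=> //; split=> //; split.
- apply: inj_surj_bijective => [xi eta e|xi'].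
    by apply: ext => z; apply: uinj; rewrite -!PhiE e.
  have [xi xiE] := pull xi'; exists xi; apply: ext' => z.
  by rewrite PhiE xiE.
- move=> a xi eta; apply: ext' => z.
  by rewrite (theta_linear hT') !PhiE -ulin (theta_linear hT).
- move=> xi f; apply: ext' => z; rewrite PhiE.
  have [_ _ -> _ _] := hT; have [_ _ -> _ _] := hT'.
  by rewrite PhiE (linear_mapZ (ulin z)) sphi.
- move=> xi eta; suff : hm_ip (Phi xi) (Phi eta) =1 hm_ip xi eta.
    by move=> /funext e; exact: val_inj.
  move=> x; rewrite (theta_ipE hT') (theta_ipE hT).
  rewrite (@reindex_fsbig _ _ _ _ _ phi (tw_s (t:=Z) @^-1` [set x])).
    by apply: eq_fsbigr => z _; rewrite !PhiE uip.
  split=> [z /= <-|z z' _ _|z' /= sz']; first exact: sphi.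
    exact: (can_inj phiK).
  by exists (psi z') => //=; rewrite -sphi psiK.
- move=> f xi; apply: ext' => z; rewrite PhiE.
  have [_ _ _ _ ->] := hT; have [_ _ _ _ ->] := hT'.
  by rewrite PhiE (linear_mapZ (ulin z)) rphi.
Qed.
End twisted_isos.

(** * Orthonormal frames of an atlas and their sections *)

Lemma set_type_cvg (S : Type) (F : set_system S) (T : topologicalType) (A : set T)
    (g : S -> set_type A) (y : set_type A) : Filter F ->
  (fun s => set_val (g s)) @ F --> set_val y -> g @ F --> y.
Proof.
move=> FF gy N [_ [[B oB <-] /= By] BN].
have := gy _ (open_nbhs_nbhs (conj oB By)); rewrite /nbhs/=.
by apply: filterS => s /=; exact: BN.
Qed.

Section atlas_frames.
Variables (R : realType) (X : topologicalType) (V : bundleData R X) (W : set X).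
Local Notation C := (Cplx R).
Hypothesis hV : is_hermitian_bundle V W.
Variables (I : choiceType) (U : I -> set X) (n : I -> nat).
Variable h : forall (i : I) (x : X), 'cV[C]_(n i) -> fib V x.
Arguments h : clear implicits.
Hypothesis atl : is_atlas U h W.

Lemma atlas_linear i x : U i x ->
  forall (a : C) v w, h i x (a *: v + w) = a *: h i x v + h i x w.
Proof. by move=> Ux; have [_ /(_ i)[_ + _ _] _] := atl; apply. Qed.

Lemma atlas_bij i x : U i x -> bijective (h i x).
Proof. by move=> Ux; have [_ /(_ i)[_ _ + _] _] := atl; apply. Qed.

Lemma atlas_sub i : U i `<=` W.
Proof. by have [<- _ _] := atl; exact: bigcup_sup. Qed.

Lemma atlas_cover x : W x -> exists i, U i x.
Proof. by have [<- _ _] := atl => -[i _ Ux]; exists i. Qed.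

Lemma atlas_triv i : is_trivialization (U i) (h i).
Proof. by have [_ + _] := atl; apply. Qed.

Lemma atlas_ip i x : U i x -> forall v w : 'cV[C]_(n i),
  fip (h i x v) (h i x w) = (v ^t* *m w) 0 0.
Proof. by move=> Ux; have [_ _ +] := atl; apply. Qed.

Lemma frame_invK i x (w : fib V x) : U i x -> h i x (frame_inv h i w) = w.
Proof.
move=> Ux; have [g _ gK] := atlas_bij Ux.
by have := @xgetPex _ 0 [set v | h i x v = w]; apply; exists (g w); exact: gK.
Qed.

Lemma frame_invE i x v : U i x -> frame_inv h i (h i x v) = v.
Proof. by move=> Ux; apply: (bij_inj (atlas_bij Ux)); rewrite frame_invK. Qed.

Lemma delta_ip m (v : 'cV[C]_m) k : ((delta_mx k 0 : 'cV[C]_m) ^t* *m v) 0 0 = v k 0.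
Proof.
rewrite mxE (bigD1 k)//= !mxE !eqxx rmorph1 mul1r big1 ?addr0// => l lk.
by rewrite !mxE (negPf lk) rmorph0 mul0r.
Qed.

Lemma frame_inv_fip i x (w : fib V x) k : U i x ->
  frame_inv h i w k 0 = fip (h i x (delta_mx k 0)) w.
Proof.
by move=> Ux; rewrite -[in RHS](frame_invK w Ux) atlas_ip// delta_ip.
Qed.

Lemma frame_ip i x (k l : 'I_(n i)) : U i x ->
  fip (h i x (delta_mx k 0)) (h i x (delta_mx l 0)) = (k == l)%:R.
Proof. by move=> Ux; rewrite atlas_ip// delta_ip mxE eqxx andbT. Qed.

Lemma frame_expand i x (w : fib V x) : U i x ->
  w = \sum_k fip (h i x (delta_mx k 0)) w *: h i x (delta_mx k 0).
Proof.
move=> Ux; rewrite -[LHS](frame_invK _ Ux) [frame_inv h i w]cV_delta.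
rewrite (linear_map_sum (atlas_linear Ux)); apply: eq_bigr => k _.
by rewrite (linear_mapZ (atlas_linear Ux)) frame_inv_fip.
Qed.

Lemma frame_parseval i x (v w : fib V x) : U i x -> fip v w =
  \sum_k (fip (h i x (delta_mx k 0)) v)^* * fip (h i x (delta_mx k 0)) w.
Proof.
move=> Ux; rewrite {1}(frame_expand v Ux) (fipl_sum hV); apply: eq_bigr => k _.
by rewrite (fiplZ hV).
Qed.

Lemma frame_eq i x (v w : fib V x) : U i x ->
  (forall k, fip (h i x (delta_mx k 0)) v = fip (h i x (delta_mx k 0)) w) -> v = w.
Proof.
move=> Ux e; rewrite [LHS](frame_expand _ Ux) [RHS](frame_expand _ Ux).
by apply: eq_bigr => k _; rewrite e.
Qed.

Lemma frame_cvg i (v : 'cV[C]_(n i)) (S : Type) (F : set_system S) (b : S -> X) x :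
  Filter F -> b @ F --> x -> U i x ->
  (fun s => pt (h i (b s) v)) @ F --> pt (h i x v).
Proof.
move=> FF bx Ux.
exact: (@triv_cvg _ _ _ _ _ _ (atlas_triv i) _ F b x FF bx Ux (fun=> v) v (cvg_cst v)).
Qed.

Section frame_sections.
Variable gamma : I -> X -> R.
Hypotheses (gamma_cont : forall i, continuous (gamma i))
  (gamma_ge0 : forall i x, 0 <= gamma i x)
  (gamma_supp : forall i, [set x | gamma i x != 0] = U i)
  (Ucpt : forall i, compact (closure (U i))).

Lemma frame_sectionE i (k : 'I_(n i)) x : U i x ->
  frame_section U h gamma k x = (gamma i x)%:C%C *: h i x (delta_mx k 0).
Proof.
move=> Ux; rewrite /frame_section mem_set//.
by rewrite (linear_mapZ (atlas_linear Ux)).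
Qed.

Lemma frame_section_out i (k : 'I_(n i)) x : ~ U i x ->
  frame_section U h gamma k x = 0.
Proof. by move=> nUx; rewrite /frame_section memNset. Qed.

Lemma gamma_out i x : ~ U i x -> gamma i x = 0.
Proof. by rewrite -gamma_supp /= => /negP/negPn/eqP. Qed.

Lemma gamma_neq0 i x : U i x -> (gamma i x)%:C%C != 0 :> C.
Proof.
by rewrite -gamma_supp /=; apply: contra => /eqP/complexI ->.
Qed.

Lemma frame_section_ip i (k : 'I_(n i)) x :
  fip (frame_section U h gamma k x) (frame_section U h gamma k x) =
  (gamma i x)%:C%C * (gamma i x)%:C%C.
Proof.
have [Ux|nUx] := pselect (U i x); last first.
  by rewrite frame_section_out// (fipr0 hV) gamma_out// mulr0.
rewrite frame_sectionE// (fiplZ hV) (fiprZ hV) frame_ip// eqxx mulr1.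
by congr (_ * _); exact: (conjc_real (gamma i x)).
Qed.

(** Outside [U i] the chart [h i] carries no information; continuity there comes from another chart,
    since the norm of the section is [gamma i], which tends to 0. For the decay, the superlevel sets
    of [gamma i] are closed in the compact closure of [U i]. *)
Lemma frame_section_Gamma0 i (k : 'I_(n i)) : Gamma0 W (frame_section U h gamma k).
Proof.
split.
- by move=> x nWx; apply: frame_section_out => /atlas_sub.
- apply: continuous_in_subspaceT => x /set_mem Wx.
  suff : (fun y => pt (frame_section U h gamma k y)) @ x -->
    pt (frame_section U h gamma k x) by [].
  have gc : (fun y => (gamma i y)%:C%C : C) @ x --> ((gamma i x)%:C%C : C).
    exact: (cvg_complex _ (@gamma_cont i x)).
  have [Ux|nUx] := pselect (U i x).
    rewrite frame_sectionE//.
    apply: (@cvg_near_ext _ _ _ _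
      (fun y => pt ((gamma i y)%:C%C *: h i y (delta_mx k 0)))).
      have := triv_near (atlas_triv i) (@cvg_id _ (nbhs x)) Ux.
      by apply: filterS => y Uy; rewrite frame_sectionE.
    apply: (@scale_cvg _ _ _ _ hV _ (nbhs x) id x _ cvg_id Wx
      (fun y => h i y (delta_mx k 0)) _ _ _ _ gc).
    exact: (@frame_cvg i (delta_mx k 0) X (nbhs x) id x (nbhs_filter x) cvg_id Ux).
  rewrite frame_section_out//; have [j Ujx] := atlas_cover Wx.
  apply: (@fip0_cvg _ _ _ _ (nbhs x) id x _ cvg_id _ _ _ _ (atlas_triv j) Ujx).
    by move=> y Uy v w; exact: atlas_ip.
  rewrite (_ : (fun s => _) = fun y => (gamma i y)%:C%C * (gamma i y)%:C%C); last first.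
    by apply/funext => y; rewrite frame_section_ip.
  rewrite (_ : 0 = (gamma i x)%:C%C * (gamma i x)%:C%C); last first.
    by rewrite gamma_out// mulr0.
  exact: (cvgM gc gc).
- move=> eps e0; have [e er] := complex_gt0 e0.
  have {}e0 : 0 < e by rewrite er ltcR in e0.
  exists [set x | e <= gamma i x]; split.
  + have clK : closed [set x | e <= gamma i x].
      by apply: (@closed_comp _ _ (gamma i) [set t | e <= t]);
        [move=> x _; exact: gamma_cont|exact: closed_ge].
    apply: (subclosed_compact clK (@Ucpt i)) => x /= ex.
    apply: subset_closure; apply: contrapT => /gamma_out g0.
    by move: ex; rewrite g0 leNgt e0.
  + move=> x /= ex; apply: (@atlas_sub i); apply: contrapT => /gamma_out g0.
    by move: ex; rewrite g0 leNgt e0.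
  + move=> x /= /negP; rewrite -ltNge => gx.
    by rewrite frame_section_ip -expr2 sqrCK ?er ?lecR ?ltcR.
Qed.
End frame_sections.
End atlas_frames.

(** * The glued space and its line bundle *)

Section gluing.
Local Open Scope quotient_scope.
Variables (R : realType) (X : topologicalType) (V : bundleData R X) (W : set X).
Local Notation C := (Cplx R).
Variables (I : choiceType) (U : I -> set X) (n : I -> nat).
Variable h : forall (i : I) (x : X), 'cV[C]_(n i) -> fib V x.
Arguments h : clear implicits.
Hypotheses (atl : is_atlas U h W) (nrm : normalizing U h).
Local Notation sheets := (sheets U n).

Definition sheet_vec (a : sheets) : fib V (sheet_base a) :=
  h (sheet_chart a) (sheet_base a) (delta_mx (sheet_index a) 0).

Lemma sheet_baseP (a : sheets) : U (sheet_chart a) (sheet_base a).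
Proof. exact: (set_valP (tagged a)). Qed.

(* [x, k, w, j] |-> w h_j(x, e_k) is well defined, hence separates the classes
   of the two quotients. *)
Lemma line_glue_pt (p q : sheets * C) : line_glue h p q ->
  pt (p.2 *: sheet_vec p.1) = pt (q.2 *: sheet_vec q.1).
Proof.
case: p q => [a w] [b w'] [/= eab [lambda [sigma [[lambda1 sbij tE] eib ->]]]].
have Ub := sheet_baseP b; have Ua := sheet_baseP a.
have -> : sheet_vec b =
    h (sheet_chart b) (sheet_base b) (delta_mx (sigma (sheet_index a)) 0).
  by rewrite /sheet_vec eib.
rewrite /sheet_vec -eab in Ub *; congr pt.
have -> : h (sheet_chart a) (sheet_base a) (delta_mx (sheet_index a) 0) =
    h (sheet_chart b) (sheet_base a)
      (lambda 0 (sigma (sheet_index a)) *: delta_mx (sigma (sheet_index a)) 0).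
  rewrite -[LHS](frame_invK atl _ Ub); congr h.
  apply/matrixP => l j; rewrite ord1.
  have := congr1 (fun M : 'M[C]_(n (sheet_chart b), n (sheet_chart a)) =>
    M l (sheet_index a)) tE.
  rewrite mxE => ->; rewrite mul_diag_mx !mxE eqxx andbT.
  by have [->//|] := eqVneq l; rewrite !mulr0.
by rewrite (linear_mapZ (atlas_linear atl Ub)) scalerA eib mulrC.
Qed.

Lemma line_equiv_pt (p q : sheets * C) :
  clos_refl_sym_trans _ (line_glue h) p q ->
  pt (p.2 *: sheet_vec p.1) = pt (q.2 *: sheet_vec q.1).
Proof.
elim=> [p1 q1 /line_glue_pt//|//|p1 q1 _ //|p1 q1 r1 _ -> _ ->//].
Qed.

(** Along a chain of elementary gluings the phases multiply, and a backward step inverts its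
    phase. *)
Lemma sheet_equiv_line (a b : sheets) :
  clos_refl_sym_trans _ (sheet_glue h) a b ->
  exists mu : C, `|mu| = 1 /\
    forall w, clos_refl_sym_trans _ (line_glue h) (a, w) (b, mu * w).
Proof.
elim=> [a1 b1 [eab [lambda [sigma [dec eib]]]]|a1|a1 b1 _ [mu [mu1 muE]]|
    a1 b1 c1 _ [mu [mu1 muE]] _ [nu [nu1 nuE]]].
- exists (lambda 0 (sheet_index b1)); split; first by case: dec.
  by move=> w; apply: rst_step; split=> //; exists lambda, sigma.
- by exists 1; rewrite normr1; split=> // w; rewrite mul1r; exact: rst_refl.
- have mu0 : mu != 0 by rewrite -normr_eq0 mu1 oner_eq0.
  exists mu^-1; rewrite normfV mu1 invr1; split=> // w.
  by apply: rst_sym; have := muE (mu^-1 * w); rewrite mulVKf.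
- exists (nu * mu); rewrite normrM mu1 nu1 mulr1; split=> // w.
  by rewrite -mulrA; apply: rst_trans (muE w) (nuE _).
Qed.

Lemma class_ofP (T : topologicalType) (G : T -> T -> Prop) (a b : T) :
  class_of G a = class_of G b <-> clos_refl_sym_trans T G a b.
Proof.
rewrite /class_of; split=> [e|ab].
  by have /eqmodP/asboolP : \pi_{eq_quot (generated_equiv_rel G)} a =
     \pi_{eq_quot (generated_equiv_rel G)} b by exact: e.
by apply/eqmodP; apply/asboolP.
Qed.

Lemma class_reprK (T : topologicalType) (G : T -> T -> Prop) (q : quotient_space G) :
  class_of G (class_repr q) = q.
Proof. exact: (@reprK _ {eq_quot (generated_equiv_rel G)} q). Qed.

Lemma sheet_base_equiv (a b : sheets) :
  clos_refl_sym_trans _ (sheet_glue h) a b -> sheet_base a = sheet_base b.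
Proof. by elim=> [a1 b1 []|//|//|a1 b1 c1 _ -> _ ->]. Qed.
End gluing.

Section twisted_frames.
Variables (R : realType) (Y X : topologicalType).
Local Notation C := (Cplx R).
Variables (E : correspondence R Y X) (Z : twistedData R Y X).
Variable V : bundleData R X.
Variable Psi : E -> forall x, fib V x.
Variables (I : choiceType) (U : I -> set X) (n : I -> nat).
Variable h : forall (i : I) (x : X), 'cV[C]_(n i) -> fib V x.
Arguments h : clear implicits.
Hypotheses (atl : is_atlas U h (range (tw_s (t := Z)))) (nrm : normalizing U h).
Local Notation sheets := (sheets U n).
Local Notation vec := (sheet_vec h).

(* The points [x, k, i] of the glued space and the vectors [x, k, w, i] of the
   glued line bundle, transported to Z. *)
Record twisted_frame (zpt : sheets -> tw_space Z)
    (ell : forall a : sheets, C -> fib (tw_line Z) (zpt a)) : Prop := TwistedFrame {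
  tf_base : forall a, tw_s (zpt a) = sheet_base a;
  tf_surj : forall z i, U i (tw_s z) -> exists (k : 'I_(n i)) (y : set_type (U i)),
    set_val y = tw_s z /\ zpt (sheet_pt k y) = z;
  tf_linear : forall a (c : C) v w, ell a (c * v + w) = c *: ell a v + ell a w;
  tf_ip : forall a v w, fip (ell a v) (ell a w) = v^* * w;
  tf_onto : forall a v, exists w, ell a w = v;
  tf_compat : forall a b, zpt a = zpt b -> exists mu : C,
    [/\ `|mu| = 1, pt (vec a) = pt (mu *: vec b) &
        forall w, pt (ell a w) = pt (ell b (mu * w))];
  tf_cvg : forall i (k : 'I_(n i)), continuous (fun y => zpt (sheet_pt k y));
  tf_line_cvg : forall i (k : 'I_(n i)),
    continuous (fun p : set_type (U i) * C => pt (ell (sheet_pt k p.1) p.2));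
  tf_range : forall (f : C0 R Y) a,
    fiber_op Psi f (vec a) = f (tw_r (zpt a)) *: vec a }.

Lemma sheet_pt_continuous i (k : 'I_(n i)) :
  continuous (fun y => sheet_pt k y : sheets).
Proof.
exact: (@existT_continuous _ (fun p : {i : I & 'I_(n i)} => set_type (U (tag p)))
  (existT _ i k)).
Qed.

Lemma class_of_continuous (T : topologicalType) (G : T -> T -> Prop) :
  continuous (class_of G).
Proof. exact: pi_continuous. Qed.

Lemma twisted_frame_exists : atlas_corresponds U h Psi Z ->
  exists zpt ell, @twisted_frame zpt ell.
Proof.
move=> [rho hrho [psi [/homeomorphism_inverse[psi' [cpsi _ psiK psiK']] spsi rpsi]]].
move=> [u [ulin ubij uip [F [/homeomorphism_inverse[F' [cF _ FK _]] FE]]]].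
pose zpt (a : sheets) := psi (class_of (sheet_glue h) a).
have ex_ell a : exists ell : C -> fib (tw_line Z) (zpt a),
    [/\ forall (c : C) v w, ell (c * v + w) = c *: ell v + ell w,
        forall v w, fip (ell v) (ell w) = v^* * w,
        forall v, exists w, ell w = v &
        forall w, pt (ell w) = F (class_of (line_glue h) (a, w))].
  set q := class_of (sheet_glue h) a.
  have /class_ofP/sheet_equiv_line[mu [mu1 muE]] :
    class_of (sheet_glue h) (class_repr q) = class_of (sheet_glue h) a.
    by rewrite class_reprK.
  have mu0 : mu != 0 by rewrite -normr_eq0 mu1 oner_eq0.
  (* [atlas_line] coordinatizes the fiber over [q] by the representative [class_repr q], which is
     glued to [a] with phase [mu]; the factor [mu^-1] passes to the coordinate given by [a]. *)
  exists (fun w => u q (mu^-1 * w)); split.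
  - by move=> c v w; rewrite mulrDr mulrCA -ulin.
  - move=> v w; rewrite uip /= rmorphM mulrACA.
    rewrite [X in X * _ = _]mulrC -normCK normfV mu1 invr1 expr1n mul1r.
    exact: erefl.
  - move=> v; have [g _ gK] := ubij q; exists (mu * (g v : C)).
    by rewrite mulKf// gK.
  - move=> w; rewrite -FE; congr F; apply/class_ofP.
    by have := muE (mu^-1 * w); rewrite mulVKf.
have [ell ellP] : exists ell : forall a, C -> fib (tw_line Z) (zpt a), forall a,
    [/\ forall (c : C) v w, ell a (c * v + w) = c *: ell a v + ell a w,
        forall v w, fip (ell a v) (ell a w) = v^* * w,
        forall v, exists w, ell a w = v &
        forall w, pt (ell a w) = F (class_of (line_glue h) (a, w))].
  by exists (fun a => sval (cid (ex_ell a))) => a; exact: (svalP (cid (ex_ell a))).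
have base_repr (a : sheets) :
    sheet_base (class_repr (class_of (sheet_glue h) a)) = sheet_base a.
  by apply: (sheet_base_equiv (h := h)); apply/class_ofP; rewrite class_reprK.
exists zpt, ell; split; try by move=> a; case: (ellP a).
- by move=> a; rewrite /zpt spsi /= base_repr.
(* The representative of [psi' z] may lie over another chart; the permutation in the monomial
   transition matrix moves it to chart [i]. *)
- move=> z i; rewrite -[z]psiK' spsi /=; set a := class_repr (psi' z) => Ua.
  have [lambda [sigma dec]] := nrm Ua (sheet_baseP a).
  exists (sigma (sheet_index a)), (SigSub (mem_set Ua)); split=> //.
  rewrite /zpt; congr psi; rewrite -[RHS]class_reprK; apply/class_ofP.
  apply: rst_sym; apply: rst_step; split=> //; exists lambda, sigma; split=> //.
- move=> a b /(can_inj psiK)/class_ofP/sheet_equiv_line[mu [mu1 muE]].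
  exists mu; split=> // [|w].
    have /= := line_equiv_pt atl (muE 1).
    by rewrite scale1r mulr1.
  case: (ellP a) => _ _ _ ->; case: (ellP b) => _ _ _ ->; congr F.
  exact/class_ofP.
- move=> i k y.
  apply: (@cvg_comp _ _ _ (fun y => class_of (sheet_glue h) (sheet_pt k y)) psi);
    last exact: cpsi.
  apply: (@cvg_comp _ _ _ (fun y => sheet_pt k y) (class_of (sheet_glue h)));
    last exact: class_of_continuous.
  exact: sheet_pt_continuous.
- move=> i k [y w].
  rewrite (_ : (fun p : set_type (U i) * C => _) =
    fun p => F (class_of (line_glue h) (sheet_pt k p.1, p.2))); last first.
    by apply/funext => p; case: (ellP (sheet_pt k p.1)).
  apply: (@cvg_comp _ _ _ (fun p : set_type (U i) * C =>
     class_of (line_glue h) (sheet_pt k p.1, p.2)) F); last exact: cF.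
  apply: (@cvg_comp _ _ _ (fun p : set_type (U i) * C =>
     (sheet_pt k p.1, p.2)) (class_of (line_glue h))); last exact: class_of_continuous.
  have c1 : (fun p : set_type (U i) * C => sheet_pt k p.1 : sheets) @ (y, w) -->
      (sheet_pt k y : sheets).
    apply: (@cvg_comp _ _ _ fst (fun y => sheet_pt k y : sheets) _ _ _ cvg_fst).
    exact: sheet_pt_continuous.
  have c2 : (fun p : set_type (U i) * C => p.2) @ (y, w) --> w by exact: cvg_snd.
  exact: (cvg_pair c1 c2).
- move=> f [[i k] y]; rewrite /zpt rpsi; exact: (hrho f i k y).
Qed.
End twisted_frames.

(** Vectors whose base points are not syntactically equal are compared as points of the total space,
    and equal points have equal base points. *)
Lemma fip_pt_eq (R : realType) (B : topologicalType) (V : bundleData R B) (W : set B)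
    (eta : forall x, fib V x) x y (v : fib V x) (w : fib V y) :
  is_hermitian_bundle V W -> pt v = pt w -> fip v (eta x) = fip w (eta y).
Proof.
move=> hV e; have xy : x = y by rewrite -(hb_prK hV v) e (hb_prK hV).
by move: w e; rewrite -xy => w /(hb_pt_inj hV) ->.
Qed.

(** * The isomorphism of E with Gamma_0 of Z given by the atlas *)

Section bundle_sections.
Variables (R : realType) (X : topologicalType).
Local Notation C := (Cplx R).
Variables (E : hilbertModule R X) (W : set X) (V : bundleData R X).
Hypothesis hV : is_hermitian_bundle V W.
Variable Psi : E -> forall x, fib V x.
Hypothesis hPsi : section_iso W Psi.
Variables (I : choiceType) (U : I -> set X) (n : I -> nat).
Variable h : forall (i : I) (x : X), 'cV[C]_(n i) -> fib V x.
Arguments h : clear implicits.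
Hypotheses (atl : is_atlas U h W) (Ucpt : forall i, compact (closure (U i))).
Variable gamma : I -> X -> R.
Hypotheses (gamma_cont : forall i, continuous (gamma i))
  (gamma_ge0 : forall i x, 0 <= gamma i x)
  (gamma_supp : forall i, [set x | gamma i x != 0] = U i).

Lemma psi_Gamma0 xi : Gamma0 W (Psi xi).
Proof. by have [_ <- _ _ _] := hPsi; exists xi. Qed.

Lemma frame_section_lift i (k : 'I_(n i)) :
  exists xi, Psi xi = frame_section U h gamma k.
Proof.
have := frame_section_Gamma0 hV atl gamma_cont gamma_ge0 gamma_supp Ucpt k.
by have [_ <- _ _ _] := hPsi => -[xi _ <-]; exists xi.
Qed.

(** On [U i] the weight [gamma i x] is nonzero, so frame sections divided by it realize every
    vector. In particular the [xget] in [fiber_op] picks a genuine preimage there. *)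
Lemma psi_at i x (v : fib V x) : U i x -> exists xi, Psi xi x = v.
Proof.
move=> Ux; have [_ _ lin _ _] := hPsi.
have lift (k : 'I_(n i)) (a : C) : exists xi, Psi xi x = a *: h i x (delta_mx k 0).
  have [xi xiE] := frame_section_lift k.
  have [zr zrE] : exists eta, Psi eta x = 0.
    by exists 0; exact: (linear_map0 (fun a xi eta => lin a xi eta x)).
  exists ((a / (gamma i x)%:C%C) *: xi + zr); rewrite lin zrE addr0 xiE.
  by rewrite (frame_sectionE atl _ _ Ux) scalerA divfK// (gamma_neq0 gamma_supp Ux).
rewrite (frame_expand atl v Ux).
pose xi k := sval (cid (lift k (fip (h i x (delta_mx k 0)) v))).
exists (\sum_k xi k); rewrite (linear_map_sum (fun a xi eta => lin a xi eta x)).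
by apply: eq_bigr => k _; exact: (svalP (cid (lift k _))).
Qed.

End bundle_sections.

Section frame_isos.
Variables (R : realType) (Y X : topologicalType).
Local Notation C := (Cplx R).
Variables (E : correspondence R Y X) (Z : twistedData R Y X).
Hypothesis hZ : is_proper_twisted Z.
Hypothesis hEZ : twisted_associated E Z.
Local Notation W := (range (tw_s (t := Z))).
Variable V : bundleData R X.
Hypothesis hV : is_hermitian_bundle V W.
Variable Psi : E -> forall x, fib V x.
Hypothesis hPsi : section_iso W Psi.
Variables (I : choiceType) (U : I -> set X) (n : I -> nat).
Variable h : forall (i : I) (x : X), 'cV[C]_(n i) -> fib V x.
Arguments h : clear implicits.
Hypotheses (atl : is_atlas U h W) (Ucpt : forall i, compact (closure (U i))).
Variable gamma : I -> X -> R.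
Hypotheses (gamma_cont : forall i, continuous (gamma i))
  (gamma_ge0 : forall i x, 0 <= gamma i x)
  (gamma_supp : forall i, [set x | gamma i x != 0] = U i).
Local Notation sheets := (sheets U n).
Local Notation vec := (sheet_vec h).
Variables (zpt : sheets -> tw_space Z)
  (ell : forall a : sheets, C -> fib (tw_line Z) (zpt a)).
Hypothesis tf : twisted_frame Psi h ell.

Definition coord (xi : E) (a : sheets) : C := fip (vec a) (Psi xi (sheet_base a)).

(** If the frame vector changes by a phase [mu], the coordinate changes by its conjugate and the
    coordinate of the line by [mu]; the two factors cancel. *)
Lemma coord_compat xi a b : zpt a = zpt b ->
  pt (ell a (coord xi a)) = pt (ell b (coord xi b)).
Proof.
move=> /(tf_compat tf)[mu [mu1 muv ->]]; rewrite /coord (fip_pt_eq (Psi xi) hV muv).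
by rewrite (fiplZ hV) mulrA -normCK mu1 expr1n mul1r.
Qed.

Lemma zpt_surj z : exists a, zpt a = z.
Proof.
have [i Ui] := atlas_cover atl (ex_intro2 _ _ z Logic.I erefl : W (tw_s z)).
by have [k [y [_ <-]]] := tf_surj tf Ui; exists (sheet_pt k y).
Qed.

Lemma frame_theta_exists : exists Theta : E -> forall z, fib (tw_line Z) z,
  forall xi a, Theta xi (zpt a) = ell a (coord xi a).
Proof.
have ex xi z : exists v : fib (tw_line Z) z,
    forall a, zpt a = z -> pt (ell a (coord xi a)) = pt v.
  have [a0 <-] := zpt_surj z.
  by exists (ell a0 (coord xi a0)) => a; exact: coord_compat.
exists (fun xi z => sval (cid (ex xi z))) => xi a.
apply: (hb_pt_inj (line_hermitian hZ)).
by rewrite -(svalP (cid (ex xi (zpt a))) a erefl).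
Qed.

(** Sheets meeting in one point have proportional frame vectors, whereas distinct vectors of an
    orthonormal frame are orthogonal. *)
Lemma zpt_sheet_inj i (y : set_type (U i)) :
  injective (fun k : 'I_(n i) => zpt (sheet_pt k y)).
Proof.
move=> k l /= /(tf_compat tf)[mu [mu1 /(hb_pt_inj hV) muv _]].
have Uy : U i (set_val y) by exact: set_valP.
apply/eqP/negPn/negP => kl.
have /eqP := @frame_ip _ _ _ _ _ _ _ _ atl i (set_val y) k k Uy.
rewrite eqxx {2}[h i _ _]muv (fiprZ hV).
rewrite (frame_ip atl _ _ Uy) (negPf kl) mulr0 eq_sym.
by rewrite oner_eq0.
Qed.

Lemma fiber_sum i (y : set_type (U i)) (g : tw_space Z -> C) :
  \sum_(z \in tw_s (t := Z) @^-1` [set set_val y]) g z =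
  \sum_k g (zpt (sheet_pt k y)).
Proof.
rewrite (@reindex_fsbig _ _ _ _ _ (fun k : 'I_(n i) => zpt (sheet_pt k y))
  [set: 'I_(n i)]).
  rewrite [RHS]fsbig_seq ?index_enum_uniq//; apply: eq_fsbigl.
  by apply/seteqP; split=> k //= _; rewrite mem_index_enum.
split=> [k _ /=|k l _ _|z /= sz]; first exact: (tf_base tf).
  exact: zpt_sheet_inj.
have Uz : U i (tw_s z) by rewrite sz; exact: set_valP.
have [k [y' [yz <-]]] := tf_surj tf Uz; exists k => //; congr (zpt (sheet_pt k _)).
by apply: val_inj; move: yz; rewrite sz.
Qed.

(** Near the given point [tw_s] is injective. Both [z] and the point of sheet [k] over [tw_s z] lie
    in that neighborhood and have the same image, so they coincide: the sheet covers a
    neighborhood. *)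
Lemma zpt_near i (k : 'I_(n i)) (y : set_type (U i)) :
  \forall z \near zpt (sheet_pt k y), exists y' : set_type (U i),
    set_val y' = tw_s z /\ zpt (sheet_pt k y') = z.
Proof.
set z0 := zpt _.
have sc := local_homeomorphism_continuous (tw_s_local_homeo hZ).
have [N [oN Nz inj]] := local_homeomorphism_inj (tw_s_local_homeo hZ) z0.
have [_ [[B oB <-] /= By] BN] := 
  tf_cvg tf (open_nbhs_nbhs (conj oN (Nz : N (zpt (sheet_pt k y))))).
have Uy : U i (set_val y) by exact: set_valP.
have sz0 : tw_s z0 = set_val y by rewrite /z0 (tf_base tf).
have [oU _ _ _] := atlas_triv atl i.
have nB : nbhs z0 (tw_s (t := Z) @^-1` (B `&` U i)).
  by apply: sc; rewrite sz0; apply: open_nbhs_nbhs; split=> //; exact: openI.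
have nN : nbhs z0 N by exact: open_nbhs_nbhs.
apply: filterS2 nB nN => z [/= Bz Uz] Nz'.
exists (SigSub (mem_set Uz)); split=> //; apply: inj => //.
  by apply: BN.
by rewrite (tf_base tf).
Qed.

Lemma coord_cvg xi i (k : 'I_(n i)) (y : set_type (U i)) :
  (fun y => coord xi (sheet_pt k y)) @ y --> coord xi (sheet_pt k y).
Proof.
have Uy : U i (set_val y) by exact: set_valP.
have vc : set_val @ y --> set_val y by exact: initial_continuous.
apply: (@fip_cvg _ _ _ _ hV _ (nbhs y) set_val (set_val y) _ vc (atlas_sub atl Uy)
  (fun y => h i (set_val y) (delta_mx k 0)) (fun y => Psi xi (set_val y))).
  exact: (frame_cvg atl (v := delta_mx k 0) (nbhs_filter y) vc Uy).
exact: (Gamma0_cvg (hb_open hV) (nbhs_filter y) (psi_Gamma0 hPsi xi)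
  (atlas_sub atl Uy) vc).
Qed.

Lemma ell_cvg i (k : 'I_(n i)) (S : Type) (F : set_system S)
    (g : S -> set_type (U i)) (w : S -> C) (y : set_type (U i)) (w0 : C) :
  Filter F -> g @ F --> y -> w @ F --> w0 ->
  (fun s => pt (ell (sheet_pt k (g s)) (w s))) @ F --> pt (ell (sheet_pt k y) w0).
Proof.
move=> FF gy ww.
apply: (@cvg_comp _ _ _ (fun s => (g s, w s))
  (fun p : set_type (U i) * C => pt (ell (sheet_pt k p.1) p.2)) _ _ _ (cvg_pair gy ww)).
have c := @tf_line_cvg _ _ _ _ _ _ _ _ _ _ _ _ _ tf i k; exact: (c (y, w0)).
Qed.

Lemma sheets_ind (P : sheets -> Prop) :
  (forall i (k : 'I_(n i)) (y : set_type (U i)), P (sheet_pt k y)) -> forall a, P a.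
Proof. by move=> Psh [[i k] y]; exact: Psh. Qed.

Lemma tf_sub_linear a (c : C) v w : ell a (c *: (v : C^o) + w) = c *: ell a v + ell a w.
Proof. exact: (tf_linear tf). Qed.

Lemma ell_scale a w : ell a w = w *: ell a 1.
Proof.
have := @linear_mapZ _ C^o _ (ell a) (tf_sub_linear a) w 1.
by rewrite /GRing.scale /= mulr1.
Qed.

Section theta.
Variable Theta : E -> forall z, fib (tw_line Z) z.
Hypothesis ThetaE : forall xi a, Theta xi (zpt a) = ell a (coord xi a).

Lemma frame_theta_continuous xi : continuous (fun z => pt (Theta xi z)).
Proof.
move=> z; have [a az] := zpt_surj z.
elim/sheets_ind: a az => i k y <-; set z0 := zpt _.
pose P z (y' : set_type (U i)) := set_val y' = tw_s z /\ zpt (sheet_pt k y') = z.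
(* [g] is a local inverse of the sheet [k], with the arbitrary value [y] where no inverse exists. *)
have [g gP] : exists g : tw_space Z -> set_type (U i),
    forall z, (exists y', P z y') -> P z (g z).
  suff ex z' : exists y, (exists y', P z' y') -> P z' y.
    by have [g gP] := choice ex; exists g.
  by have [[y' Py']|nP] := pselect (exists y', P z' y'); [exists y'|exists y].
have near_g : \forall z \near z0, P z (g z).
  by have := zpt_near k y; apply: filterS => z' /gP.
have sc := local_homeomorphism_continuous (tw_s_local_homeo hZ).
have gc : g @ z0 --> y.
  apply: set_type_cvg; rewrite -(_ : tw_s z0 = set_val y); last exact: (tf_base tf).
  by apply: (cvg_near_ext _ _ (sc z0)); apply: filterS near_g => z' [].
suff : (fun z => pt (Theta xi z)) @ z0 --> pt (Theta xi z0) by [].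
rewrite /z0 ThetaE.
apply: (@cvg_near_ext _ _ _ _
  (fun z => pt (ell (sheet_pt k (g z)) (coord xi (sheet_pt k (g z)))))).
  by apply: filterS near_g => z' [_ e]; rewrite -ThetaE e.
apply: (ell_cvg _ gc).
exact: (@cvg_comp _ _ _ g (fun y => coord xi (sheet_pt k y)) _ _ _ gc
  (@coord_cvg xi i k y)).
Qed.

Lemma frame_theta_norm xi z : fip (Theta xi z) (Theta xi z) <=
  fip (Psi xi (tw_s z)) (Psi xi (tw_s z)).
Proof.
have [a <-] := zpt_surj z; elim/sheets_ind: a => i k y.
rewrite ThetaE (tf_ip tf) (tf_base tf) /sheet_base /=.
have Uy : U i (set_val y) by exact: set_valP.
rewrite (frame_parseval hV atl _ _ Uy) (bigD1 k)//= lerDl.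
by apply: sumr_ge0 => l _; rewrite -normCKC exprn_ge0.
Qed.

(** A single coordinate is at most the norm of the vector, so decay off [K] passes to decay off the
    preimage of [K], which is compact as [tw_s] is proper onto its image. *)
Lemma frame_theta_Gamma0 xi : Gamma0 setT (Theta xi).
Proof.
split; first by move=> z; case.
  by apply: continuous_subspaceT; exact: frame_theta_continuous.
move=> eps e0; have [_ _ /(_ eps e0)[K [cK KW xiK]]] := psi_Gamma0 hPsi xi.
exists (tw_s (t := Z) @^-1` K); split=> //; first exact: (tw_s_proper hZ).
move=> z /xiK; apply: le_lt_trans.
by rewrite ler_sqrtC ?frame_theta_norm// nnegrE;
  [exact: (hb_ip_ge0 (line_hermitian hZ))|exact: (hb_ip_ge0 hV)].
Qed.

(** The preimage is the section of [V] whose coordinates in every frame [h i] are the coordinates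
    [D] of [eta]; [tf_compat] makes this consistent between charts. *)
Lemma frame_theta_onto eta : Gamma0 setT eta -> exists xi, Theta xi = eta.
Proof.
move=> eta0; have hL := line_hermitian hZ.
pose D a : C := fip (ell a 1) (eta (zpt a)).
have DE a : ell a (D a) = eta (zpt a).
  have [w wE] := tf_onto tf (eta (zpt a)).
  by rewrite /D -wE (tf_ip tf) rmorph1 mul1r.
have [zeta zetaE] : exists zeta : forall x, fib V x, forall x,
    (forall i (k : 'I_(n i)) (y : set_type (U i)), set_val y = x ->
      fip (h i x (delta_mx k 0)) (zeta x) = D (sheet_pt k y)) /\
    (~ W x -> zeta x = 0).
  have ex x : exists v : fib V x,
      (forall i (k : 'I_(n i)) (y : set_type (U i)), set_val y = x ->
      fip (h i x (delta_mx k 0)) v = D (sheet_pt k y)) /\ (~ W x -> v = 0).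
    have [Wx|nWx] := pselect (W x); last first.
      exists 0; split=> // i k y yx; exfalso; apply: nWx; rewrite -yx.
      by apply: (atlas_sub atl); exact: set_valP.
    have [i Ux] := atlas_cover atl Wx.
    pose y : set_type (U i) := SigSub (mem_set Ux).
    (* The vector is defined in chart [i]. The point of sheet [l] of chart [j] over [x] also lies on
       a sheet [k] of chart [i], and one phase [mu] relates both the frame vectors and the values of
       [D]. *)
    exists (\sum_k D (sheet_pt k y) *: h i x (delta_mx k 0)); split=> // j l y' y'x.
    have sb : tw_s (zpt (sheet_pt l y')) = x by rewrite (tf_base tf).
    have [k [y'' [y''x zE]]] : exists (k : 'I_(n i)) (y'' : set_type (U i)),
       set_val y'' = tw_s (zpt (sheet_pt l y')) /\
       zpt (sheet_pt k y'') = zpt (sheet_pt l y').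
      by apply: (tf_surj tf); rewrite sb.
    have {y''x} yy : y'' = y by apply: val_inj; exact: (etrans y''x sb).
    rewrite {}yy in zE.
    have [mu [mu1 muv mul]] := tf_compat tf (esym zE).
    rewrite {2}/D (fip_pt_eq eta hL (mul 1)) mulr1.
    rewrite ell_scale (fiplZ hL) -/(D _).
    have hvE : pt (h j x (delta_mx l 0)) = pt (mu *: h i x (delta_mx k 0)).
      rewrite -[RHS](muv : _ = pt (mu *: h i x (delta_mx k 0))).
      by rewrite /sheet_vec /sheet_base /= y'x.
    rewrite (hb_pt_inj hV hvE) (fiplZ hV); congr (_ * _).
    rewrite (fipr_sum hV) (bigD1 k)//= (fiprZ hV) (frame_ip atl _ _ Ux) eqxx mulr1.
    rewrite big1 ?addr0// => m mk; rewrite (fiprZ hV) (frame_ip atl _ _ Ux).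
    by rewrite eq_sym (negPf mk) mulr0.
  exists (fun x => sval (cid (ex x))) => x; exact: (svalP (cid (ex x))).
have zeta_ip x i (y : set_type (U i)) : set_val y = x -> fip (zeta x) (zeta x) =
    \sum_(z \in tw_s (t := Z) @^-1` [set x]) fip (eta z) (eta z).
  move=> yx; have Ux : U i x by rewrite -yx; exact: set_valP.
  rewrite (frame_parseval hV atl _ _ Ux) -yx fiber_sum; apply: eq_bigr => k _.
  rewrite yx; have [zE _] := zetaE x.
  by rewrite (zE i k y yx) -DE (tf_ip tf).
have zetaG : Gamma0 W zeta.
  split; first by move=> x; case: (zetaE x).
    apply: continuous_in_subspaceT => x /set_mem Wx.
    suff : (fun x' => pt (zeta x')) @ x --> pt (zeta x) by [].
    have [i Ux] := atlas_cover atl Wx; have [oU _ _ _] := atlas_triv atl i.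
    pose y : set_type (U i) := SigSub (mem_set Ux).
    pose g x' := insubd y x'; have gE x' : U i x' -> set_val (g x') = x'.
      by move=> Ux'; apply: insubdK; rewrite inE.
    have nU : nbhs x (U i) by exact: open_nbhs_nbhs.
    have gc : g @ x --> y.
      apply: set_type_cvg; apply: (cvg_near_ext _ _ (@cvg_id _ (nbhs x))).
      by apply: filterS nU => x'; exact: gE.
    pose c x' : 'cV[C]_(n i) := \col_k D (sheet_pt k (g x')).
    have zc x' : U i x' -> zeta x' = h i x' (c x').
      move=> Ux'; apply: (frame_eq atl Ux') => k.
      rewrite (atlas_ip atl Ux') delta_ip mxE.
      by have [zE _] := zetaE x'; rewrite (zE i k (g x')) ?gE.
    rewrite zc//; apply: (@cvg_near_ext _ _ _ _ (fun x' => pt (h i x' (c x')))).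
      by apply: filterS nU => x' /zc ->.
    apply: (@triv_cvg _ _ _ _ _ _ (atlas_triv atl i) _ (nbhs x) id x _ cvg_id Ux).
    apply: cvg_mx_entries => k j; rewrite mxE.
    rewrite (_ : (fun x' => _) = fun x' => D (sheet_pt k (g x'))); last first.
      by apply/funext => x'; rewrite mxE.
    have Dc y1 : (fun y => D (sheet_pt k y)) @ y1 --> D (sheet_pt k y1).
      have zc1 : (fun y => zpt (sheet_pt k y)) @ y1 --> zpt (sheet_pt k y1).
        exact: (tf_cvg tf).
      apply: (@fip_cvg _ _ _ _ hL _ (nbhs y1) _ _ _ zc1 Logic.I
        (fun y => ell (sheet_pt k y) 1) (fun y => eta (zpt (sheet_pt k y)))).
        exact: (ell_cvg (nbhs_filter y1) cvg_id (cvg_cst _)).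
      exact: (Gamma0_cvg openT (nbhs_filter y1) eta0 Logic.I zc1).
    have gx : g x = y by apply: val_inj; exact: gE.
    rewrite gx.
    exact: (@cvg_comp _ _ _ g (fun y => D (sheet_pt k y)) _ _ _ gc (Dc y)).
  (* The number of sheets may be unbounded, so decay of eta does not bound
     |zeta|^2 = <eta, eta>; that this function lies in C_0(X) is part of the
     hypothesis that Gamma_0 of Z is a Hilbert module. *)
  move=> eps e0; case: hEZ => Theta0 hT0.
  have [xi0 xi0E] := theta_surj hT0 eta0.
  pose f := hm_ip xi0 xi0.
  have fE x : f x = \sum_(z \in tw_s (t := Z) @^-1` [set x]) fip (eta z) (eta z).
    by rewrite /f (theta_ipE hT0) xi0E.
  have fzeta x : f x = fip (zeta x) (zeta x).
    have [Wx|nWx] := pselect (W x).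
      have [i Ux] := atlas_cover atl Wx.
      by rewrite fE (zeta_ip x i (SigSub (mem_set Ux))).
    have [_ /(_ nWx) ->] := zetaE x; rewrite (fipr0 hV) fE.
    rewrite (_ : _ @^-1` _ = set0) ?fsbig_set0//.
    by apply/seteqP; split=> // z /= zx; apply: nWx; exists z.
  have /set_mem[fc fv] := c0_funP f.
  have e20 : 0 < eps ^+ 2 by rewrite exprn_gt0.
  have [K0 [cK0 fK0]] := fv _ e20.
  have f_ge0 x : 0 <= f x by rewrite fzeta; exact: (hb_ip_ge0 hV).
  have [e er] := complex_gt0 e20.
  exists [set x | eps ^+ 2 <= f x]; split.
  - apply: (@subclosed_compact _ _ K0) => //.
      rewrite -openC openE => x /= /negP.
      rewrite -real_ltNge ?ger0_real ?(ltW e20)// => fx.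
      have d0 : 0 < eps ^+ 2 - f x by rewrite subr_gt0.
      move/cvgrPdist_lt: (fc x) => /(_ _ d0); apply: filterS => x' /= lt.
      apply/negP; rewrite -real_ltNge ?ger0_real ?(ltW e20)//.
      rewrite -[f x'](subrK (f x)) -ltrBrDr (le_lt_trans _ lt)// distrC.
      by rewrite real_ler_norm// realB// ger0_real.
    move=> x /= ef; apply: contrapT => /fK0.
    by rewrite ger0_norm// => fe; have := le_lt_trans ef fe; rewrite ltxx.
  - move=> x /= ef; apply: contrapT => nWx.
    move: ef; rewrite fzeta; have [_ /(_ nWx) ->] := zetaE x.
    by rewrite (fipr0 hV) => /(lt_le_trans e20); rewrite ltxx.
  - move=> x /= /negP; rewrite -real_ltNge ?ger0_real ?(ltW e20)// => fe.
    rewrite -fzeta -(sqrCK (ltW e0)) ltr_sqrtC ?nnegrE//.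
    exact: ltW.
have [xi xiE] : exists xi, Psi xi = zeta.
  by have [_ Pr _ _ _] := hPsi; move: zetaG; rewrite -Pr => -[xi _ <-]; exists xi.
exists xi; apply: functional_extensionality_dep => z.
have [a <-] := zpt_surj z; elim/sheets_ind: a => i k y.
rewrite ThetaE /coord xiE -DE; congr ell.
by have [zE _] := zetaE (set_val y); exact: (zE i k y erefl).
Qed.
Lemma coord_eq0 xi : (forall a, coord xi a = 0) -> xi = 0.
Proof.
move=> xi0; have [inj _ lin _ _] := hPsi; apply: inj.
apply: functional_extensionality_dep => x.
rewrite [RHS](linear_map0 (fun a xi eta => lin a xi eta x)).
have [Wx|nWx] := pselect (W x); last by case: (psi_Gamma0 hPsi xi) => /(_ x nWx).
have [i Ux] := atlas_cover atl Wx; apply: (frame_eq atl Ux) => k.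
by rewrite (fipr0 hV); exact: (xi0 (sheet_pt k (SigSub (mem_set Ux)))).
Qed.

Lemma coord_linear (c : C) xi eta a :
  coord (c *: xi + eta) a = c * coord xi a + coord eta a.
Proof. by have [_ _ lin _ _] := hPsi; rewrite /coord lin (hb_ip_linear hV). Qed.

(** The range map describes the left action on frame vectors only. Moving [f] across the inner
    product as its conjugate makes it act on the frame vector, an eigenvector. *)
Lemma coord_phi (f : C0 R Y) xi a :
  coord (corr_phi f xi) a = f (tw_r (zpt a)) * coord xi a.
Proof.
have [_ _ _ _ ip] := hPsi.
have fib_a g := tf_range tf g a; rewrite /fiber_op in fib_a.
move: fib_a; set A := [set _ | _]; set xi0 := xget _ _ => fib_a.
have xi0E : Psi xi0 (sheet_base a) = vec a.
  have [zeta zetaE] := psi_at hV hPsi atl Ucpt gamma_cont gamma_ge0 gamma_supp (vec a)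
    (sheet_baseP a).
  by have := @xgetPex _ 0 A; apply; exists zeta.
rewrite /coord -xi0E -ip hm_ip_conj corr_phi_adj /=.
rewrite ip fib_a (fiprZ hV) rmorphM /= conjCK; congr (_ * _).
by rewrite -xi0E -!ip [in RHS]hm_ip_conj.
Qed.

Lemma frame_theta_section_iso : twisted_section_iso Theta.
Proof.
have [inj rPsi lin act ip] := hPsi; have hL := line_hermitian hZ.
have lin' (c : C) xi eta z : Theta (c *: xi + eta) z = c *: Theta xi z + Theta eta z.
  by have [a <-] := zpt_surj z; rewrite !ThetaE coord_linear (tf_linear tf).
split=> //.
- split.
    move=> xi eta e; apply/eqP; rewrite -subr_eq0; apply/eqP.
    apply: coord_eq0 => a.
    have : Theta (xi - eta) (zpt a) = 0.
      by rewrite addrC -scaleN1r lin' e scaleN1r addNr.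
    rewrite ThetaE ell_scale => /eqP; rewrite scaler_eq0 => /orP[/eqP//|].
    by rewrite -(fip_eq0 hL) (tf_ip tf) mulr1 rmorph1 oner_eq0.
  apply/seteqP; split=> [_ [xi _ <-]|eta /frame_theta_onto[xi <-]].
    exact: frame_theta_Gamma0.
  by exists xi.
- move=> xi f z; have [a <-] := zpt_surj z; rewrite !ThetaE (tf_base tf).
  by rewrite /coord act (fiprZ hV) [LHS]ell_scale [in RHS]ell_scale scalerA.
- move=> xi eta x; rewrite ip.
  have [Wx|nWx] := pselect (W x); last first.
    case: (psi_Gamma0 hPsi xi) => /(_ x nWx) -> _ _; rewrite (fipl0 hV).
    rewrite (_ : _ @^-1` _ = set0) ?fsbig_set0//.
    by apply/seteqP; split=> // z /= zx; apply: nWx; exists z.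
  have [i Ux] := atlas_cover atl Wx.
  rewrite (frame_parseval hV atl _ _ Ux).
  rewrite (@fiber_sum i (SigSub (mem_set Ux))); apply: eq_bigr => k _.
  by rewrite !ThetaE (tf_ip tf).
- move=> g xi z; have [a <-] := zpt_surj z; rewrite !ThetaE coord_phi.
  by rewrite [LHS]ell_scale [in RHS]ell_scale scalerA.
Qed.
End theta.
End frame_isos.

(** * Cartan subalgebras and condition (d) *)

Definition mult_ops (R : realType) (Y X : topologicalType)
    (E : correspondence R Y X) (Z : twistedData R Y X)
    (Theta : E -> forall z, fib (tw_line Z) z) : set (E -> E) :=
  [set T | exists f : C0 R (tw_space Z),
             forall xi z, Theta (T xi) z = f z *: Theta xi z].

Section cartan.
Variables (R : realType) (Y X : topologicalType).
Local Notation C := (Cplx R).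
Hypotheses (hX : hausdorff_space X) (lX : locally_compact [set: X]).
Hypotheses (hY : hausdorff_space Y) (lY : locally_compact [set: Y]).
Variables (E E' : correspondence R Y X) (Z Z' : twistedData R Y X).
Variable Theta : E -> forall z, fib (tw_line Z) z.
Variable Theta' : E' -> forall z, fib (tw_line Z') z.
Hypotheses (hZ : is_proper_twisted Z) (hT : twisted_section_iso Theta).
Hypotheses (hZ' : is_proper_twisted Z') (hT' : twisted_section_iso Theta').
Hypothesis fin : forall x, finite_set (tw_s (t := Z) @^-1` [set x]).
Hypothesis fin' : forall x, finite_set (tw_s (t := Z') @^-1` [set x]).

Lemma mult_op_exists (f : C0 R (tw_space Z)) (K : set (tw_space Z)) :
  compact K -> (forall z, ~ K z -> f z = 0) ->
  exists T, forall xi z, Theta (T xi) z = f z *: Theta xi z.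
Proof.
move=> cK fK; have hL := line_hermitian hZ; have /set_mem[fc _] := c0_funP f.
suff ex xi : exists eta, forall z, Theta eta z = f z *: Theta xi z.
  by have [T TE] := choice ex; exists T.
suff /(theta_surj hT)[eta etaE] : Gamma0 setT (fun z => f z *: Theta xi z).
  by exists eta => z; rewrite etaE.
split; first by move=> z; case.
  apply: continuous_subspaceT => z.
  have xic := theta_cvg hT (xi := xi) (nbhs_filter z) (@cvg_id _ (nbhs z)).
  exact: (@scale_cvg _ _ _ _ hL _ (nbhs z) id z _ cvg_id I _ _ f (f z) xic (fc z)).
move=> eps e0; exists K; split=> // z /fK ->.
by rewrite scale0r (fipr0 hL) sqrtC0.
Qed.

(** Conjugation by [Phi] turns multiplication by [f] into multiplication by [f] composed with [psi],
    the inverse of the homeomorphism. *)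
Lemma twisted_iso_cartan : twisted_iso Z Z' ->
  exists (Phi : E -> E') (Phi' : E' -> E),
    [/\ corr_iso Phi, cancel Phi Phi', cancel Phi' Phi &
        (fun T : E -> E => Phi \o T \o Phi') @` mult_ops Theta = mult_ops Theta'].
Proof.
move=> /(twisted_iso_corr_iso hZ hT hZ' hT')[phi [psi [u [Phi]]]].
move=> [[cphi cpsi phiK psiK] sphi ulin uinj [isoPhi uE]].
have [[Phi' PhiK PhiK'] _ _ _ _] := isoPhi.
have uZ z := linear_mapZ (ulin z).
have ext' (xi eta : E') :
    (forall z, Theta' xi (phi z) = Theta' eta (phi z)) -> xi = eta.
  move=> e; have [[inj _] _ _ _ _] := hT'; apply: inj.
  by apply: functional_extensionality_dep => z'; rewrite -[z']psiK.
exists Phi, Phi'; split=> //; apply/seteqP; split=> [_ [T [f fT] <-]|T' [f fT']].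
  have [g gE] := c0_comp f cphi cpsi psiK.
  exists g => xi z'; rewrite -[z']psiK /= uE fT uZ -uE PhiK'.
  by rewrite gE phiK.
exists (Phi' \o T' \o Phi); last first.
  by apply/funext => xi /=; rewrite !PhiK'.
have [g gE] := c0_comp f cpsi cphi phiK.
exists g => xi z; apply: uinj; rewrite uZ -!uE /= PhiK' fT'.
by rewrite gE.
Qed.

Lemma cartan_twisted_iso (Phi : E -> E') (Phi' : E' -> E) :
  corr_iso Phi -> cancel Phi Phi' ->
  (fun T : E -> E => Phi \o T \o Phi') @` mult_ops Theta `<=` mult_ops Theta' ->
  twisted_iso Z Z'.
Proof.
move=> isoPhi PhiK sub.
apply: (kernel_relation_twisted_iso hX lX hY lY hZ hT hZ' hT' fin fin' isoPhi) => z.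
have [_ lin _ ip _] := isoPhi.
have [G [oG Gz inj]] := local_homeomorphism_inj (tw_s_local_homeo hZ) z.
have [f [K [fz cK KG fK]]] :=
  @c0_bump R _ (tw_hausdorff hZ) (tw_locally_compact hZ) z G oG Gz.
have [T TE] := mult_op_exists cK fK.
have [g gE] : mult_ops Theta' (Phi \o T \o Phi').
  by apply: sub; exists T => //; exists f.
have {}gE xi z' : Theta' (Phi (T xi)) z' = g z' *: Theta' (Phi xi) z'.
  by have := gE (Phi xi) z'; rewrite /= PhiK.
have [w w0] := line_neq0 hZ z; have [xi [xiz xi0]] := theta_fiber_bump hZ hT w.
(* Inner products are preserved pointwise on X, so vanishing on a whole fiber of [tw_s] is
   preserved. *)
have zero eta : (forall y, tw_s y = tw_s z -> Theta eta y = 0) ->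
    forall z', tw_s z' = tw_s z -> Theta' (Phi eta) z' = 0.
  move=> eta0; apply/(theta_ip0 hZ' hT' fin'); rewrite ip.
  exact/(theta_ip0 hZ hT fin).
(* Any point of the fiber where the image of [xi] survives will do: [g] is shown to be nonzero
   there. *)
have [z' [sz' xiz']] : exists z', tw_s z' = tw_s z /\ Theta' (Phi xi) z' <> 0.
  apply: contrapT => nex; have : hm_ip xi xi (tw_s z) = 0.
    rewrite -ip; apply/(theta_ip0 hZ' hT' fin') => z' sz'.
    by apply: contrapT => n0; apply: nex; exists z'.
  move/(theta_ip0 hZ hT fin)/(_ z erefl); rewrite xiz => w00.
  by rewrite w00 eqxx in w0.
have f0 y : tw_s y = tw_s z -> y <> z -> f y = 0.
  by move=> sy yz; apply: fK => /KG Gy; apply: yz; exact: inj.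
exists z' => eta etaz.
(* On the fiber, [T] keeps only the value at [z]. It therefore kills [eta], which gives this
   equation, and fixes [xi], which gives the next one. *)
have geta : g z' *: Theta' (Phi eta) z' = 0.
  rewrite -gE; apply: zero sz' => y sy; rewrite TE.
  have [->|yz] := pselect (y = z); first by rewrite etaz scaler0.
  by rewrite f0// scale0r.
have gxi : g z' *: Theta' (Phi xi) z' = Theta' (Phi xi) z'.
  rewrite -gE; apply/eqP; rewrite -subr_eq0 addrC -scaleN1r; apply/eqP.
  rewrite -(theta_linear hT') -lin; apply: zero sz' => y sy.
  rewrite (theta_linear hT) TE.
  have [->|yz] := pselect (y = z); first by rewrite fz scale1r scaleN1r addNr.
  by rewrite f0// scale0r xi0// scaler0 addr0.
have g0 : g z' != 0.
  by apply/eqP => g0; apply: xiz'; rewrite -gxi g0 scale0r.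
by move/eqP: geta; rewrite scaler_eq0 (negPf g0) => /eqP.
Qed.
End cartan.

(** * Monomial matrices and the matrix of an isomorphism in the frames *)

Lemma monomial_coords (R : realType) m n (A : 'M[Cplx R]_(m, n)) lambda sigma :
  monomial_decomposition A lambda sigma ->
  forall k l, A k l = lambda 0 k * (k == sigma l)%:R.
Proof. by move=> [_ _ ->] k l; rewrite mul_diag_mx !mxE. Qed.

Lemma monomial_unitaryK (R : realType) m n (A : 'M[Cplx R]_(m, n)) :
  monomial_unitary A -> A ^t* *m A = 1%:M.
Proof.
move=> [lambda [sigma dec]]; have [lambda1 sbij _] := dec.
have AE := monomial_coords dec; apply/matrixP => l l'.
rewrite !mxE (bigD1 (sigma l))//= big1 ?addr0; last first.
  by move=> k kl; rewrite !mxE AE (negPf kl) mulr0 rmorph0 mul0r.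
rewrite !mxE !AE eqxx mulr1 (inj_eq (bij_inj sbij)) mulrA -normCKC lambda1.
by rewrite expr1n mul1r.
Qed.

(** A column of norm 1 with at most one nonzero entry has there an entry of modulus 1. The adjoint
    is treated because the [r_i] of an equivalence of atlases will be the adjoint of the matrix of
    [Phi]. *)
Lemma adjoint_monomial (R : realType) m n (M : 'M[Cplx R]_(m, n)) (tau : 'I_n -> 'I_m) :
  bijective tau -> (forall k l, l != tau k -> M l k = 0) ->
  (forall k, \sum_l `|M l k| ^+ 2 = 1) -> monomial_unitary (M ^t*).
Proof.
move=> [sigma tauK sigmaK] off norm1.
exists (\row_k (M (tau k) k)^*), sigma; split.
- move=> k; rewrite mxE norm_conjC; apply/eqP.
  rewrite -(@pexpr_eq1 _ _ 2)// -(norm1 k) (bigD1 (tau k))//=.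
  by rewrite big1 ?addr0// => l lk; rewrite off// normr0 expr0n.
- by exists tau.
- apply/matrixP => k l; rewrite mul_diag_mx !mxE.
  have [->|kl] := eqVneq k (sigma l); first by rewrite sigmaK mulr1.
  rewrite mulr0 off ?rmorph0//; apply: contra kl => /eqP ->.
  by rewrite tauK.
Qed.

Section equivalences.
Variables (R : realType) (Y X : topologicalType).
Local Notation C := (Cplx R).
Variables (E E' : correspondence R Y X) (W : set X).
Variables (V V' : bundleData R X).
Hypotheses (hV : is_hermitian_bundle V W) (hV' : is_hermitian_bundle V' W).
Variables (Psi : E -> forall x, fib V x) (Psi' : E' -> forall x, fib V' x).
Hypotheses (hPsi : section_iso W Psi) (hPsi' : section_iso W Psi').
Variables (I : choiceType) (U : I -> set X) (n n' : I -> nat).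
Variable h : forall (i : I) (x : X), 'cV[C]_(n i) -> fib V x.
Variable h' : forall (i : I) (x : X), 'cV[C]_(n' i) -> fib V' x.
Arguments h : clear implicits.
Arguments h' : clear implicits.
Hypotheses (atl : is_atlas U h W) (atl' : is_atlas U h' W).
Variable gamma : I -> X -> R.
Hypotheses (gamma_cont : forall i, continuous (gamma i))
  (gamma_ge0 : forall i x, 0 <= gamma i x)
  (gamma_supp : forall i, [set x | gamma i x != 0] = U i).
Hypothesis Ucpt : forall i, compact (closure (U i)).
Local Notation e i x k := (h i x (delta_mx k 0)).
Local Notation e' i x k := (h' i x (delta_mx k 0)).
Variable Phi : E -> E'.
Hypothesis isoPhi : corr_iso Phi.

(** The difference of the two elements has norm zero at [x], and [Phi] preserves the inner product
    at each point. *)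
Lemma Phi_fiberwise xi eta x : Psi xi x = Psi eta x ->
  Psi' (Phi xi) x = Psi' (Phi eta) x.
Proof.
have [_ lin _ ip _] := isoPhi.
have [_ _ plin _ pip] := hPsi; have [_ _ plin' _ pip'] := hPsi'.
move=> xe; apply/eqP; rewrite -subr_eq0 addrC -scaleN1r -plin' -lin.
by rewrite -(fip_eq0 hV') -pip' ip pip plin xe scaleN1r addNr (fipr0 hV).
Qed.

(* The matrix of the fiber map V_x -> V'_x induced by Phi, in the frames h_i and
   h'_i; a global section through h_i(x, e_k) is xi_ik / gamma_i(x). *)
Definition Phi_mx i x : 'M[C]_(n' i, n i) := \matrix_(l, k)
  (fip (e' i x l) (Psi' (Phi (xget 0 [set xi | Psi xi = frame_section U h gamma k])) x)
   / (gamma i x)%:C%C).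

Lemma Phi_mx_lift i (k : 'I_(n i)) :
  Psi (xget 0 [set xi | Psi xi = frame_section U h gamma k]) =
  frame_section U h gamma k.
Proof.
have [xi xiE] := frame_section_lift hV hPsi atl Ucpt gamma_cont gamma_ge0 gamma_supp k.
by have := @xgetPex _ 0 [set xi | Psi xi = frame_section U h gamma k]; apply; exists xi.
Qed.

Lemma Phi_mxE i x xi l : U i x -> fip (e' i x l) (Psi' (Phi xi) x) =
  \sum_k Phi_mx i x l k * fip (e i x k) (Psi xi x).
Proof.
move=> Ux; have [_ lin _ _ _] := isoPhi.
have [_ _ plin _ _] := hPsi; have [_ _ plin' _ _] := hPsi'.
pose xk (k : 'I_(n i)) := xget 0 [set xi | Psi xi = frame_section U h gamma k].
have -> : Psi' (Phi xi) x = Psi' (Phi (\sum_k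
    (fip (e i x k) (Psi xi x) / (gamma i x)%:C%C) *: xk k)) x.
  apply: Phi_fiberwise.
  rewrite [RHS](linear_map_sum (fun a xi eta => plin a xi eta x)).
  rewrite [LHS](frame_expand atl _ Ux); apply: eq_bigr => k _.
  rewrite [RHS](linear_mapZ (fun a xi eta => plin a xi eta x)) Phi_mx_lift.
  by rewrite (frame_sectionE atl _ _ Ux) scalerA divfK// (gamma_neq0 gamma_supp Ux).
rewrite (linear_map_sum lin) (linear_map_sum (fun a xi eta => plin' a xi eta x)).
rewrite (fipr_sum hV'); apply: eq_bigr => k _.
rewrite (linear_mapZ lin) (linear_mapZ (fun a xi eta => plin' a xi eta x)).
rewrite (fiprZ hV') mxE [LHS]mulrAC [RHS]mulrAC; congr (_ / _).
exact: mulrC.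
Qed.

Lemma Phi_mx_unit i x xi (k : 'I_(n i)) l : U i x -> Psi xi x = e i x k ->
  Phi_mx i x l k = fip (e' i x l) (Psi' (Phi xi) x).
Proof.
move=> Ux xik; rewrite (Phi_mxE _ _ Ux) xik (bigD1 k)//=.
rewrite (frame_ip atl _ _ Ux) eqxx mulr1 big1 ?addr0// => k' kk'.
by rewrite (frame_ip atl _ _ Ux) (negPf kk') mulr0.
Qed.

Lemma Phi_mx_coord i x xi : U i x ->
  Psi' (Phi xi) x = h' i x (Phi_mx i x *m frame_inv h i (Psi xi x)).
Proof.
move=> Ux; apply: (frame_eq atl' Ux) => l.
rewrite (Phi_mxE _ _ Ux) (atlas_ip atl' Ux) delta_ip mxE; apply: eq_bigr => k _.
by rewrite (frame_inv_fip atl).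
Qed.

(** Both products are the matrix of the fiber map from the frame [h j] to the frame [h' i]. *)
Lemma Phi_mx_transition i j x : U i x -> U j x ->
  Phi_mx i x *m transition h i j x = transition h' i j x *m Phi_mx j x.
Proof.
move=> Ui Uj; apply/matrixP => l k; rewrite !mxE.
have [xi xiE] := psi_at hV hPsi atl Ucpt gamma_cont gamma_ge0 gamma_supp (e j x k) Uj.
transitivity (fip (e' i x l) (Psi' (Phi xi) x)).
  rewrite (Phi_mxE _ _ Ui); apply: eq_bigr => m _.
  by rewrite !mxE (frame_inv_fip atl _ _ Ui) xiE.
rewrite [in LHS](frame_expand atl' (Psi' (Phi xi) x) Uj) (fipr_sum hV').
apply: eq_bigr => m _; rewrite (fiprZ hV') mxE (frame_inv_fip atl' _ _ Ui).
by rewrite (Phi_mx_unit _ Uj xiE) mulrC.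
Qed.

(** The element of E defining a column depends on [i] and [k] but not on the point, so the entry is
    an inner product of continuous sections divided by [gamma i]. *)
Lemma Phi_mx_cvg i x l k : U i x ->
  (fun y => Phi_mx i y l k) @ x --> Phi_mx i x l k.
Proof.
move=> Ux; have Wx := atlas_sub atl' Ux.
rewrite mxE; set xi := xget _ _.
have gc : (fun y => (gamma i y)%:C%C : C) @ x --> ((gamma i x)%:C%C : C).
  exact: (cvg_complex _ (@gamma_cont i x)).
have Pc : (fun y => pt (Psi' (Phi xi) y)) @ x --> pt (Psi' (Phi xi) x).
  exact: (Gamma0_cvg (hb_open hV') (nbhs_filter x) (psi_Gamma0 hPsi' _) Wx cvg_id).
have ec : (fun y => pt (e' i y l)) @ x --> pt (e' i x l).
  exact: (frame_cvg atl' (v := delta_mx l 0) (nbhs_filter x) (@cvg_id _ (nbhs x)) Ux).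
have fc := @fip_cvg _ _ _ _ hV' _ (nbhs x) id x (nbhs_filter x) cvg_id Wx _ _ _ _ ec Pc.
rewrite (_ : (fun y => Phi_mx i y l k) = fun y =>
    fip (e' i y l) (Psi' (Phi xi) y) / (gamma i y)%:C%C); last first.
  by apply/funext => y; rewrite mxE.
exact: (cvgM fc (cvgV (gamma_neq0 gamma_supp Ux) gc)).
Qed.

Lemma Phi_mx_col_norm i x k : U i x -> \sum_l `|Phi_mx i x l k| ^+ 2 = 1.
Proof.
move=> Ux; have [_ _ _ ip _] := isoPhi.
have [_ _ _ _ pip] := hPsi; have [_ _ _ _ pip'] := hPsi'.
have [xi xiE] := psi_at hV hPsi atl Ucpt gamma_cont gamma_ge0 gamma_supp (e i x k) Ux.
transitivity (fip (Psi' (Phi xi) x) (Psi' (Phi xi) x)).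
  rewrite (frame_parseval hV' atl' _ _ Ux); apply: eq_bigr => l _.
  by rewrite normCKC (Phi_mx_unit _ Ux xiE).
by rewrite -pip' ip pip xiE (frame_ip atl _ _ Ux) eqxx.
Qed.

Lemma monomial_equivalent :
  (forall i x, U i x -> exists2 tau : 'I_(n i) -> 'I_(n' i), bijective tau &
    forall k l, l != tau k -> Phi_mx i x l k = 0) ->
  atlases_equivalent U Psi Psi' h h'.
Proof.
move=> tauP; have mono i x : U i x -> monomial_unitary ((Phi_mx i x) ^t*).
  move=> Ux; have [tau tbij off] := tauP i x Ux.
  apply: (adjoint_monomial tbij off) => k; exact: Phi_mx_col_norm.
have conjK m p (A : 'M[C]_(m, p)) : (A ^t*) ^t* = A.
  by apply/matrixP => a b; rewrite !mxE conjCK.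
split.
  move=> x; have [Wx|nWx] := pselect (W x).
    have [i Ux] := atlas_cover atl Wx; exists (n i); split.
      exists (h i x); split; first exact: (atlas_linear atl Ux).
      exact: (atlas_bij atl Ux).
    have [tau tbij _] := tauP i x Ux.
    have -> : n i = n' i by have := bij_eq_card tbij; rewrite !card_ord.
    exists (h' i x); split; first exact: (atlas_linear atl' Ux).
    exact: (atlas_bij atl' Ux).
  have dim0 (F : lmodType C) : (forall v : F, v = 0) -> has_dim F 0.
    move=> F0; exists (fun=> 0); split=> [a v w|]; first by rewrite scaler0 addr0.
    exists (fun=> 0) => v; last by rewrite [v]F0.
    by apply/matrixP => -[].
  exists 0%N; split; apply: dim0.
    exact: (hb_zero hV nWx).
  exact: (hb_zero hV' nWx).
(* The equivalence asks that [Phi] be given in the frames by the inverse of [r i x], so [r i x] is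
   the adjoint of the unitary matrix of [Phi]. *)
exists (fun i x => (Phi_mx i x) ^t*); split.
- move=> i; apply: continuous_in_subspaceT => x /set_mem Ux.
  suff : (fun y => (Phi_mx i y) ^t*) @ x --> (Phi_mx i x) ^t* by [].
  apply: cvg_mx_entries => k l.
  rewrite (_ : (fun y => _) = fun y => (Phi_mx i y l k)^*); last first.
    by apply/funext => y; rewrite !mxE.
  rewrite (_ : ((Phi_mx i x) ^t*) k l = (Phi_mx i x l k)^*); last by rewrite !mxE.
  exact: (@cvg_conj R X (nbhs x) (fun y => Phi_mx i y l k) _ _
    (@Phi_mx_cvg i x l k Ux)).
- exact: mono.
- move=> i j x Ui Uj; rewrite conjK (Phi_mx_transition Ui Uj) -mulmxA.
  have := monomial_unitaryK (mono j x Uj); rewrite conjK => ->.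
  by rewrite mulmx1.
- exists Phi => // xi i x Ux; rewrite conjK.
  exact: Phi_mx_coord.
Qed.
End equivalences.

(** * Conditions (b) and (c) *)

Section frame_points.
Variables (R : realType) (Y X : topologicalType).
Local Notation C := (Cplx R).
Variables (E : correspondence R Y X) (Z : twistedData R Y X).
Hypothesis hZ : is_proper_twisted Z.
Variable V : bundleData R X.
Variable Psi : E -> forall x, fib V x.
Variables (I : choiceType) (U : I -> set X) (n : I -> nat).
Variable h : forall (i : I) (x : X), 'cV[C]_(n i) -> fib V x.
Arguments h : clear implicits.
Variables (zpt : sheets U n -> tw_space Z)
  (ell : forall a : sheets U n, C -> fib (tw_line Z) (zpt a)).
Hypothesis tf : twisted_frame Psi h ell.
Variable Theta : E -> forall z, fib (tw_line Z) z.
Hypothesis ThetaE : forall xi a, Theta xi (zpt a) = ell a (coord Psi h xi a).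

Lemma frame_theta_eq0 xi a : Theta xi (zpt a) = 0 <-> coord Psi h xi a = 0.
Proof.
have hL := line_hermitian hZ.
rewrite ThetaE (ell_scale tf); split=> [/eqP|->]; last by rewrite scale0r.
rewrite scaler_eq0 -(fip_eq0 hL) (tf_ip tf) mulr1 rmorph1 oner_eq0 orbF.
by move/eqP.
Qed.

Lemma tf_surj_at i (y : set_type (U i)) z : tw_s z = set_val y ->
  exists k, zpt (sheet_pt k y) = z.
Proof.
move=> sz; have Uz : U i (tw_s z) by rewrite sz; exact: set_valP.
have [k [y' [yz <-]]] := tf_surj tf Uz; exists k; congr (zpt (sheet_pt k _)).
by apply: val_inj; exact: (esym (etrans yz sz)).
Qed.
End frame_points.

Section frame_equivalences.
Variables (R : realType) (Y X : topologicalType).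
Local Notation C := (Cplx R).
Hypotheses (hX : hausdorff_space X) (lX : locally_compact [set: X]).
Hypotheses (hY : hausdorff_space Y) (lY : locally_compact [set: Y]).
Variables (E E' : correspondence R Y X) (Z Z' : twistedData R Y X).
Hypotheses (hZ : is_proper_twisted Z) (hZ' : is_proper_twisted Z').
Hypothesis fin : forall x, finite_set (tw_s (t := Z) @^-1` [set x]).
Hypothesis fin' : forall x, finite_set (tw_s (t := Z') @^-1` [set x]).
Local Notation W := (range (tw_s (t := Z))).
Local Notation W' := (range (tw_s (t := Z'))).
Hypothesis WW' : W' = W.
Variables (V V' : bundleData R X).
Hypotheses (hV : is_hermitian_bundle V W) (hV' : is_hermitian_bundle V' W').
Variables (Psi : E -> forall x, fib V x) (Psi' : E' -> forall x, fib V' x).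
Hypotheses (hPsi : section_iso W Psi) (hPsi' : section_iso W' Psi').
Variables (I : choiceType) (U : I -> set X) (n n' : I -> nat).
Variable h : forall (i : I) (x : X), 'cV[C]_(n i) -> fib V x.
Variable h' : forall (i : I) (x : X), 'cV[C]_(n' i) -> fib V' x.
Arguments h : clear implicits.
Arguments h' : clear implicits.
Hypotheses (atl : is_atlas U h W) (atl' : is_atlas U h' W').
Variable gamma : I -> X -> R.
Hypotheses (gamma_cont : forall i, continuous (gamma i))
  (gamma_ge0 : forall i x, 0 <= gamma i x)
  (gamma_supp : forall i, [set x | gamma i x != 0] = U i).
Hypothesis Ucpt : forall i, compact (closure (U i)).
Variables (zpt : sheets U n -> tw_space Z)
  (ell : forall a : sheets U n, C -> fib (tw_line Z) (zpt a)).
Variables (zpt' : sheets U n' -> tw_space Z')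
  (ell' : forall a : sheets U n', C -> fib (tw_line Z') (zpt' a)).
Hypotheses (tf : twisted_frame Psi h ell) (tf' : twisted_frame Psi' h' ell').
Variable Theta : E -> forall z, fib (tw_line Z) z.
Variable Theta' : E' -> forall z, fib (tw_line Z') z.
Hypotheses (ThetaE : forall xi a, Theta xi (zpt a) = ell a (coord Psi h xi a))
  (ThetaE' : forall xi a, Theta' xi (zpt' a) = ell' a (coord Psi' h' xi a)).
Hypotheses (hT : twisted_section_iso Theta) (hT' : twisted_section_iso Theta').
Local Notation e i x k := (h i x (delta_mx k 0)).
Local Notation e' i x k := (h' i x (delta_mx k 0)).

(** Over a point of [U i] each frame indexes the fiber of its source map, so [phi] becomes a
    bijection [tau] of indices. The frame vector [k] vanishes on every line but that of sheet [k],
    hence its image has only the coordinate [tau k]. *)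
Lemma twisted_iso_atlases_equivalent : twisted_iso Z Z' ->
  atlases_equivalent U Psi Psi' h h'.
Proof.
move=> /(twisted_iso_corr_iso hZ hT hZ' hT')[phi [psi [u [Phi]]]].
move=> [[cphi cpsi phiK psiK] sphi ulin uinj [isoPhi uE]].
have hV'W := hV'; have hPsi'W := hPsi'; have atl'W := atl'.
rewrite WW' in hV'W hPsi'W atl'W.
apply: (monomial_equivalent hV hV'W hPsi hPsi'W atl atl'W gamma_cont gamma_ge0
  gamma_supp Ucpt isoPhi) => i x Ux.
pose y : set_type (U i) := SigSub (mem_set Ux).
have ex k : exists l, zpt' (sheet_pt l y) = phi (zpt (sheet_pt k y)).
  by apply: (tf_surj_at tf'); rewrite sphi (tf_base tf).
have [tau tauE] := choice ex.
have tau_surj l : exists k, tau k = l.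
  have [k kE] : exists k, zpt (sheet_pt k y) = psi (zpt' (sheet_pt l y)).
    by apply: (tf_surj_at tf); rewrite -sphi psiK (tf_base tf').
  exists k; apply: (zpt_sheet_inj hV' atl' tf' (y := y)).
  by rewrite /= tauE kE psiK.
exists tau.
  apply: inj_surj_bijective => // k l kl.
  apply: (zpt_sheet_inj hV atl tf (y := y)); apply: (can_inj phiK).
  by rewrite -!tauE kl.
move=> k l; have [k' <-] := tau_surj l => kk'.
have [xi xiE] := psi_at hV hPsi atl Ucpt gamma_cont gamma_ge0 gamma_supp (e i x k) Ux.
rewrite (Phi_mx_unit hV hV'W hPsi hPsi'W h' atl gamma_cont gamma_ge0 gamma_supp Ucpt
  isoPhi _ Ux xiE).
suff : coord Psi' h' (Phi xi) (sheet_pt (tau k') y) = 0 by [].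
apply/(frame_theta_eq0 hZ' tf' ThetaE'); rewrite tauE uE.
rewrite (_ : Theta xi _ = 0); first exact: (linear_map0 (ulin _)).
apply/(frame_theta_eq0 hZ tf ThetaE).
suff : fip (e i x k') (Psi xi x) = 0 by [].
rewrite xiE (frame_ip atl _ _ Ux); case: eqP => // kk.
by rewrite kk eqxx in kk'.
Qed.

Definition permutes_frame_sections (Phi : E -> E') : Prop :=
  forall i (k : 'I_(n i)), exists xi : E,
    Psi xi = frame_section U h gamma k /\
    forall x, U i x -> exists (l : 'I_(n' i)) (lambda : C),
      `|lambda| = 1 /\
      Psi' (Phi xi) x = lambda *: frame_section U h' gamma l x.

Lemma atlases_equivalent_permutes : atlases_equivalent U Psi Psi' h h' ->
  exists Phi : E -> E', corr_iso Phi /\ permutes_frame_sections Phi.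
Proof.
move=> [_ [r [_ mono _ [Phi isoPhi PhiE]]]]; exists Phi; split=> // i k.
have [xi xiE] := frame_section_lift hV hPsi atl Ucpt gamma_cont gamma_ge0 gamma_supp k.
exists xi; split=> // x Ux.
have [lambda [sigma dec]] := mono i x Ux; have [lambda1 [tau sigmaK tauK] _] := dec.
have rE := monomial_coords dec.
(* The only nonzero entry in row [k] of [r i x] is [lambda 0 k], in column [tau k]; the adjoint thus
   sends the basis vector [k] to the conjugate of [lambda 0 k] times the basis vector [tau k]. *)
exists (tau k), (lambda 0 k)^*; rewrite norm_conjC; split=> //.
rewrite (PhiE _ _ _ Ux) xiE (frame_sectionE atl _ _ Ux) (frame_sectionE atl' _ _ Ux).
rewrite -(linear_mapZ (atlas_linear atl Ux)) (frame_invE atl _ Ux).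
rewrite scalerA -(linear_mapZ (atlas_linear atl' Ux)); congr (h' i x).
apply/matrixP => l j; rewrite !mxE (bigD1 k)//= big1 ?addr0; last first.
  by move=> k' k'k; rewrite !mxE (negPf k'k) mulr0 mulr0.
rewrite !mxE rE eqxx ord1 eqxx andbT mulr1 rmorphM /= rmorph_nat.
rewrite mulrAC; congr (_ * _); congr (_%:R); congr nat_of_bool.
by rewrite andbT; apply/eqP/eqP => [->|->]; rewrite ?tauK ?sigmaK.
Qed.

(** Vanishing of [eta] on sheet [k] means orthogonality to the frame section at that point. This
    orthogonality is preserved by [Phi], and the image of the frame section is a nonzero multiple of
    the frame vector [l]. *)
Lemma permutes_twisted_iso (Phi : E -> E') :
  corr_iso Phi -> permutes_frame_sections Phi -> twisted_iso Z Z'.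
Proof.
move=> isoPhi perm.
apply: (kernel_relation_twisted_iso hX lX hY lY hZ hT hZ' hT' fin fin' isoPhi) => z.
have [_ _ _ ip _] := isoPhi.
have [_ _ _ _ pip] := hPsi; have [_ _ _ _ pip'] := hPsi'.
have [a <-] := zpt_surj atl tf z; elim/sheets_ind: a => i k y.
have Ux : U i (set_val y) by exact: set_valP.
have [xi [xiE /(_ _ Ux)[l [lambda [lambda1 PhixiE]]]]] := perm i k.
exists (zpt' (sheet_pt l y)) => eta /(frame_theta_eq0 hZ tf ThetaE) eta0.
apply/(frame_theta_eq0 hZ' tf' ThetaE').
have eta0x : fip (e i (set_val y) k) (Psi eta (set_val y)) = 0 by exact: eta0.
suff : fip (e' i (set_val y) l) (Psi' (Phi eta) (set_val y)) = 0 by [].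
have : fip (Psi' (Phi xi) (set_val y)) (Psi' (Phi eta) (set_val y)) = 0.
  rewrite -pip' ip pip xiE (frame_sectionE atl _ _ Ux) (fiplZ hV) eta0x.
  by rewrite mulr0.
rewrite PhixiE (frame_sectionE atl' _ _ Ux) (fiplZ hV') (fiplZ hV') mulrA => /eqP.
rewrite mulf_eq0 => /orP[|/eqP//]; rewrite mulf_eq0 !conjC_eq0.
rewrite (negPf (gamma_neq0 gamma_supp Ux)) orbF -normr_eq0 lambda1.
by rewrite oner_eq0.
Qed.
End frame_equivalences.

Theorem proposition4p14
  (R : realType) (X Y : topologicalType)
  (hX : hausdorff_space X) (lX : locally_compact [set: X])
  (hY : hausdorff_space Y) (lY : locally_compact [set: Y])
  (E E' : correspondence R Y X)
  (Z Z' : twistedData R Y X)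
  (hZ : is_proper_twisted Z) (hZ' : is_proper_twisted Z')
  (hEZ : twisted_associated E Z) (hEZ' : twisted_associated E' Z')
  (V V' : bundleData R X)
  (hV : is_hermitian_bundle V (range (tw_s (t := Z))))
  (hV' : is_hermitian_bundle V' (range (tw_s (t := Z'))))
  (dimV : forall x, exists m : nat,
     tw_s (t := Z) @^-1` [set x] #= `I_m /\ has_dim (fib V x) m)
  (dimV' : forall x, exists m : nat,
     tw_s (t := Z') @^-1` [set x] #= `I_m /\ has_dim (fib V' x) m)
  (Psi : E -> forall x, fib V x) (Psi' : E' -> forall x, fib V' x)
  (hPsi : section_iso (range (tw_s (t := Z))) Psi)
  (hPsi' : section_iso (range (tw_s (t := Z'))) Psi')
  (I : choiceType) (U : I -> set X) (n n' : I -> nat)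
  (h : forall (i : I) (x : X), 'cV[Cplx R]_(n i) -> fib V x)
  (h' : forall (i : I) (x : X), 'cV[Cplx R]_(n' i) -> fib V' x)
  (atl : is_atlas U h (range (tw_s (t := Z))))
  (atl' : is_atlas U h' (range (tw_s (t := Z'))))
  (nrm : normalizing U h) (nrm' : normalizing U h')
  (diag : diagonalizing U h Psi) (diag' : diagonalizing U h' Psi')
  (hhZ : atlas_corresponds U h Psi Z)
  (hhZ' : atlas_corresponds U h' Psi' Z')
  (gamma : I -> X -> R)
  (gamma_cont : forall i, continuous (gamma i))
  (gamma_ge0 : forall i x, 0 <= gamma i x)
  (gamma_supp : forall i, [set x | gamma i x != 0] = U i)
  (D : set (E -> E)) (D' : set (E' -> E'))
  (DK : D `<=` @compact_ops R X E) (DK' : D' `<=` @compact_ops R X E')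
  (hD : cartan_corresponds Z D) (hD' : cartan_corresponds Z' D') :
  let a := twisted_iso Z Z' in
  let b := atlases_equivalent U Psi Psi' h h' in
  let c := exists Phi : E -> E', corr_iso Phi /\
    forall i (k : 'I_(n i)), exists xi : E,
      Psi xi = frame_section U h gamma k /\
      forall x, U i x -> exists (l : 'I_(n' i)) (lambda : Cplx R),
        `|lambda| = 1 /\
        Psi' (Phi xi) x = lambda *: frame_section U h' gamma l x in
  let d := exists (Phi : E -> E') (Phi_inv : E' -> E),
    [/\ corr_iso Phi, cancel Phi Phi_inv, cancel Phi_inv Phi &
        (fun T : E -> E => Phi \o T \o Phi_inv) @` D = D'] in
  [/\ a <-> b, a <-> c & a <-> d].
Proof.
move=> a b c d.
have fin x : finite_set (tw_s (t := Z) @^-1` [set x]).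
  by have [m [sm _]] := dimV x; exists m.
have fin' x : finite_set (tw_s (t := Z') @^-1` [set x]).
  by have [m [sm _]] := dimV' x; exists m.
(* The two atlases have the same open cover, so both source maps have the same image. *)
have WW' : range (tw_s (t := Z')) = range (tw_s (t := Z)).
  by have [<- _ _] := atl; have [<- _ _] := atl'.
have [Ucpt _] := diag.
have [zpt [ell tf]] := twisted_frame_exists atl nrm hhZ.
have [zpt' [ell' tf']] := twisted_frame_exists atl' nrm' hhZ'.
case: (frame_theta_exists hZ hV atl tf) => Theta ThetaE.
case: (frame_theta_exists hZ' hV' atl' tf') => Theta' ThetaE'.
have hT := frame_theta_section_iso hZ hEZ hV hPsi atl Ucpt gamma_cont gamma_ge0
  gamma_supp tf ThetaE.
have hT' := frame_theta_section_iso hZ' hEZ' hV' hPsi' atl' Ucpt gamma_cont gamma_ge0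
  gamma_supp tf' ThetaE'.
have ab : a -> b.
  exact: (twisted_iso_atlases_equivalent hZ hZ' WW' hV hV' hPsi hPsi' atl atl'
    gamma_cont gamma_ge0 gamma_supp Ucpt tf tf' ThetaE ThetaE' hT hT').
have bc : b -> c.
  exact: (atlases_equivalent_permutes hV hPsi atl atl' gamma_cont gamma_ge0
    gamma_supp Ucpt).
have ca : c -> a.
  move=> [Phi [isoPhi perm]].
  exact: (permutes_twisted_iso hX lX hY lY hZ hZ' fin fin' hV hV' hPsi hPsi' atl
    atl' gamma_supp tf tf' ThetaE ThetaE' hT hT' isoPhi perm).
(* For (d), the isomorphisms that define [D] and [D'] replace those built from the atlases. *)
case: hD hD' => T0 hT0 DE [T0' hT0' DE'].
have ad : a -> d.
  rewrite /d DE DE'; exact: (twisted_iso_cartan hZ hT0 hZ' hT0').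
have da : d -> a.
  move=> [Phi [Phi' [isoPhi PhiK PhiK' DD']]].
  apply: (cartan_twisted_iso hX lX hY lY hZ hT0 hZ' hT0' fin fin' isoPhi PhiK).
  by rewrite /mult_ops -DE -DE' DD'.
by split; split=> //; [move=> /bc/ca|move=> /ab/bc].
Qed.
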